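(* Let $q\in L^1_{\mathrm{loc}}(\mathbb R)$. Then the minimal operator $D_{\min}(q)$ is essentially $\mathcal J$-self-adjoint in $L^2(\mathbb R)^2$, i.e. $\overline{D_{\min}(q)}=\mathcal J D_{\min}(q)^*\mathcal J$. Moreover $\overline{D_{\min}(q)}=D_{\max}(q)$, and hence $D_{\max}(q)$ is $\mathcal J$-self-adjoint: $\mathcal J D_{\max}(q)\mathcal J=D_{\max}(q)^*$.
   Context: $M(q)=i\begin{pmatrix}\frac{d}{dx}&-q\\-\overline q&-\frac{d}{dx}\end{pmatrix}$. $D_{\max}(q)F=M(q)F$ on $\{F\in L^2(\mathbb R)^2: F\in AC_{\mathrm{loc}}(\mathbb R)^2,\ M(q)F\in L^2(\mathbb R)^2\}$; $D_{\min}(q)$ is the restriction of $D_{\max}(q)$ to elements with compact support. $\mathcal C$ is componentwise complex conjugation, $\sigma_1=\begin{pmatrix}0&1\\1&0\end{pmatrix}$, $\mathcal J=\sigma_1\mathcal C$ (an antilinear conjugation on $L^2(\mathbb R)^2$). A densely defined operator $S$ is $\mathcal J$-self-adjoint if $S=\mathcal J S^*\mathcal J$. *)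

(* Defs.v *)
(* Operators on L^2(R)^2 are represented by their
   graphs, i.e. relations on functions R -> C * C; equality of operators is
   equality of graphs modulo almost-everywhere equality (L^2 classes). *)
From mathcomp Require Import all_boot all_order all_algebra.
From mathcomp Require Import all_classical all_reals all_analysis.
From mathcomp Require Import complex.
Set Implicit Arguments. Unset Strict Implicit. Unset Printing Implicit Defensive.
Import Order.TTheory GRing.Theory Num.Theory.
Local Open Scope classical_set_scope.
Local Open Scope ring_scope.

Section Defs.
Context {R : realType}.
Local Notation C := (R[i]).
Local Notation mu := (@lebesgue_measure R).

(* a function R -> C^2 (a representative of an element of L^2(R)^2) *)
Definition vfun := R -> (C * C)%type.
(* an operator in L^2(R)^2, given by its graph *)
Definition op := vfun -> vfun -> Prop.

(* q in L^1_loc(R) : real and imaginary parts are locally integrable *)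
Definition L1loc (q : R -> C) :=
  locally_integrable setT (fun x => complex.Re (q x)) /\
  locally_integrable setT (fun x => complex.Im (q x)).

Definition sqn (z : C) : R := complex.Re z ^+ 2 + complex.Im z ^+ 2.
Definition nsq (F : vfun) (x : R) : R := sqn (F x).1 + sqn (F x).2.

(* F in L^2(R)^2 *)
Definition L2 (F : vfun) :=
  [/\ measurable_fun setT (fun x => complex.Re (F x).1),
      measurable_fun setT (fun x => complex.Im (F x).1),
      measurable_fun setT (fun x => complex.Re (F x).2),
      measurable_fun setT (fun x => complex.Im (F x).2) &
      (\int[mu]_x (nsq F x)%:E < +oo)%E].

(* equality almost everywhere (= equality in L^2) *)
Definition aeq (F G : vfun) := {ae mu, forall x, F x = G x}.

(* the inner product <F, G> = \int (F1 conj G1 + F2 conj G2) *)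
Definition ip (F G : vfun) : C :=
  let h x := (F x).1 * (G x).1^* + (F x).2 * (G x).2^* in
  complex.Complex (\int[mu]_x complex.Re (h x)) (\int[mu]_x complex.Im (h x)).

(* || F - G ||^2 *)
Definition dist2 (F G : vfun) : \bar R :=
  (\int[mu]_x (nsq (fun y => ((F y).1 - (G y).1, (F y).2 - (G y).2)) x)%:E)%E.

(* absolute continuity on [a, b] (Vitali's definition) *)
Definition abs_cont_on (a b : R) (f : R -> R) :=
  forall e : R, 0 < e -> exists2 d : R, 0 < d &
    forall (n : nat) (x y : nat -> R),
      (forall k, (k < n)%N -> [/\ a <= x k, x k <= y k & y k <= b]) ->
      (forall j k, (j < k)%N -> (k < n)%N -> y j <= x k) ->
      \sum_(k < n) (y k - x k) < d ->
      \sum_(k < n) `|f (y k) - f (x k)| < e.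

(* locally absolutely continuous real function *)
Definition locAC (f : R -> R) := forall a b : R, a <= b -> abs_cont_on a b f.

(* F in AC_loc(R)^2 *)
Definition ACloc (F : vfun) :=
  [/\ locAC (fun x => complex.Re (F x).1), locAC (fun x => complex.Im (F x).1),
      locAC (fun x => complex.Re (F x).2) & locAC (fun x => complex.Im (F x).2)].

(* differentiability / derivative of a complex-valued function of a real variable *)
Definition cderivable (f : R -> C) (x : R) :=
  derivable (fun t => complex.Re (f t)) x 1 /\
  derivable (fun t => complex.Im (f t)) x 1.
Definition cderive (f : R -> C) (x : R) : C :=
  complex.Complex (derive1 (fun t => complex.Re (f t)) x)
                  (derive1 (fun t => complex.Im (f t)) x).

(* (M(q)F)(x) = i ( F1' - q F2 , - conj(q) F1 - F2' ) *)
Definition Mq (q : R -> C) (F : vfun) (x : R) : (C * C)%type :=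
  ('i * (cderive (fun t => (F t).1) x - q x * (F x).2),
   'i * (- (q x)^* * (F x).1 - cderive (fun t => (F t).2) x)).

(* maximal operator: graph {(F, M(q)F)} *)
Definition Dmax (q : R -> C) : op := fun F G =>
  [/\ L2 F, ACloc F, L2 G &
      {ae mu, forall x, [/\ cderivable (fun t => (F t).1) x,
                            cderivable (fun t => (F t).2) x & G x = Mq q F x]}].

(* minimal operator: restriction of D_max to compactly supported elements *)
Definition Dmin (q : R -> C) : op := fun F G =>
  Dmax q F G /\ exists a b : R, forall x, x < a \/ b < x -> F x = (0, 0).

(* equality of operators in L^2 (graphs modulo a.e. equality) *)
Definition opeq (S T : op) :=
  forall F G,
    (exists F' G', [/\ aeq F F', aeq G G' & S F' G']) <->
    (exists F' G', [/\ aeq F F', aeq G G' & T F' G']).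

(* Hilbert space adjoint: (F', G') in graph S^* iff <S F, F'> = <F, G'> *)
Definition adj (S : op) : op := fun F' G' =>
  [/\ L2 F', L2 G' & forall F G, S F G -> ip G F' = ip F G'].

(* operator closure: closure of the graph in L^2 x L^2 *)
Definition closure_op (S : op) : op := fun F G =>
  [/\ L2 F, L2 G & exists (Fs Gs : nat -> vfun),
      [/\ forall n, S (Fs n) (Gs n),
          (fun n => dist2 (Fs n) F) @ \oo --> 0%E &
          (fun n => dist2 (Gs n) G) @ \oo --> 0%E]].

(* the conjugation J = sigma_1 C *)
Definition Jmap (F : vfun) : vfun := fun x => ((F x).2^*, (F x).1^*).
(* J S J (J is an involution) *)
Definition Jconj (S : op) : op := fun F G => S (Jmap F) (Jmap G).

End Defs.

(* Main.v *)
(* M(q) = i sigma_3 (d/dx - A) with A = ((0, q), (- q^*, 0)) antihermitian, so a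
   unitary fundamental matrix Y of F' = A F turns M(q) into i sigma_3 Y (d/dx) Y^-1.
   If (F, G) is in the adjoint of D_min(q), testing against the columns of Y times
   trapezoidal functions therefore shows that a unitary transform of F has a locally
   integrable weak derivative, and the du Bois-Reymond lemma gives
   D_min(q)^* = D_max(-q).  Conversely D_max(q) is contained in the closure of
   D_min(q): cutting F off with a function of slope 1/n changes M(q)F by a term of
   norm at most ||F||/n, so that nothing has to be known about F at infinity.  The
   closure of D_min(q) is contained in D_min(-q)^* = D_max(q), and everything else
   follows from J D_max(q) J = D_max(-q). *)
Require Import Defs.
From mathcomp Require Import all_boot all_order all_algebra.
From mathcomp Require Import all_classical all_reals all_analysis.
From mathcomp Require Import measurable_realfun.
From mathcomp Require Import complex.
From mathcomp Require Import ring lra.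
Set Implicit Arguments. Unset Strict Implicit. Unset Printing Implicit Defensive.
Import Order.TTheory GRing.Theory Num.Theory.
Import numFieldNormedType.Exports.
Local Open Scope classical_set_scope.
Local Open Scope ring_scope.

(** * Absolutely continuous functions *)

Section AbsolutelyContinuous.
Context {R : realType}.
Local Notation mu := (@lebesgue_measure R).
Implicit Types (f g h : R -> R) (a b C : R).

(** The obstacle is that [q] is only locally integrable: for a smooth compactly supported [F] the
    products of [q] with its components need not be square integrable, so smooth functions cannot
    serve as test functions for [Dmin q]. A real trapezoid times a solution of M(q)Y = 0 can: the
    terms containing [q] cancel, and the image is bounded with compact support. Such solutions are
    merely absolutely continuous and differentiable almost everywhere, so the argument rests on two
    real-variable facts: a locally absolutely continuous function whose derivative vanishes almost
    everywhere is constant, and linear systems with locally integrable coefficients have global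
    solutions. The passage from q to -q is that of the formal adjoint: i sigma_3 d/dx is formally
    symmetric, while the off-diagonal part of M(q) is antihermitian. *)

Lemma abs_cont_on_dominated a b C f g h : 0 < C ->
  (forall u v, a <= u -> u <= v -> v <= b ->
     `|h v - h u| <= C * (`|f v - f u| + `|g v - g u|)) ->
  abs_cont_on a b f -> abs_cont_on a b g -> abs_cont_on a b h.
Proof.
move=> C0 hfg ACf ACg e e0.
have e2C : 0 < e / (2 * C) by rewrite divr_gt0// mulr_gt0.
have [df df0 Hf] := ACf _ e2C.
have [dg dg0 Hg] := ACg _ e2C.
exists (Num.min df dg) => [|n x y xy yx]; first by rewrite lt_min df0.
rewrite lt_min => /andP[sf sg].
apply: (@le_lt_trans _ _ (\sum_(k < n) C * (`|f (y k) - f (x k)| + `|g (y k) - g (x k)|))).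
  by apply: ler_sum => k _; have [? ? ?] := xy k (ltn_ord k); exact: hfg.
rewrite -mulr_sumr big_split/=.
apply: (@lt_le_trans _ _ (C * (e / (2 * C) + e / (2 * C)))).
  by rewrite ltr_pM2l// ltrD// ?Hf ?Hg.
rewrite le_eqVlt; apply/orP; left; apply/eqP; field.
by rewrite gt_eqF.
Qed.

Lemma locAC_lipschitz f C : (forall u v, u <= v -> `|f v - f u| <= C * (v - u)) ->
  locAC f.
Proof.
move=> fC a b _.
have id_ac : abs_cont_on a b id.
  move=> e e0; exists e => // n x y xy _; apply: le_lt_trans.
  by apply: ler_sum => k _; have [_ ? _] := xy k (ltn_ord k); rewrite ger0_norm ?subr_ge0.
(* The constant is [1 + |C|], as a positive one is required while [C] may be zero. *)
apply: (abs_cont_on_dominated (ltr_pwDl ltr01 (normr_ge0 C)) _ id_ac id_ac).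
move=> u v _ uv _; apply: (le_trans (fC _ _ uv)).
have w0 : 0 <= v - u by rewrite subr_ge0.
have CC := ler_norm C; have C0 := normr_ge0 C.
rewrite [id v]/= [id u]/= (ger0_norm w0).
rewrite [leRHS]mulrDr -[leLHS]addr0 lerD//; last by rewrite mulr_ge0// addr_ge0.
by rewrite ler_wpM2r// ler_wpDl.
Qed.

Lemma locAC_continuous f : locAC f -> continuous f.
Proof.
move=> ACf x; apply/cvgrPdist_lt => e e0.
have x1 : x - 1 <= x + 1 by lra.
have [d d0 Hd] := ACf _ _ x1 _ e0.
have Hd1 u v : x - 1 <= u -> u <= v -> v <= x + 1 -> v - u < d -> `|f v - f u| < e.
  move=> xu uv vx vu.
  have := Hd 1%N (fun=> u) (fun=> v); rewrite !big_ord1; apply => // j k jk.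
  by rewrite ltnS leqn0 => /eqP k0; rewrite k0 in jk.
have d1 : 0 < Num.min 1 d by rewrite lt_min ltr01.
near=> y.
have : `|x - y| < Num.min 1 d.
  by near: y; exists (Num.min 1 d) => // y; rewrite /ball_/=.
rewrite lt_min => /andP[/ltr_normlP[? ?] /ltr_normlP[? ?]].
by have [xy|yx] := leP x y; [rewrite distrC|]; apply: Hd1; lra.
Unshelve. all: by end_near. Qed.

Lemma continuous_bounded f a b : continuous f ->
  exists2 M, 0 < M & forall x, a <= x <= b -> `|f x| <= M.
Proof.
move=> cf.
have [ab|ba] := leP a b; last first.
  by exists 1 => // x /andP[ax xb]; have := le_lt_trans (le_trans ax xb) ba; rewrite ltxx.
have cf' : {within `[a, b], continuous (fun x => `|f x|)}.
  apply: continuous_subspaceT => x; apply: continuous_comp; first exact: cf.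
  exact: norm_continuous.
have [c _ Hc] := EVT_max ab cf'.
exists (`|f c| + 1) => [|x xab]; first by rewrite ltr_wpDl.
by apply: (le_trans (Hc x _)); rewrite ?in_itv//= lerDl.
Qed.

Lemma locACD f g : locAC f -> locAC g -> locAC (fun x => f x + g x).
Proof.
move=> ACf ACg a b ab.
apply: (abs_cont_on_dominated ltr01 _ (ACf _ _ ab) (ACg _ _ ab)) => u v _ _ _.
by rewrite mul1r opprD addrACA ler_normD.
Qed.

Lemma locACN f : locAC f -> locAC (fun x => - f x).
Proof.
move=> ACf a b ab.
apply: (abs_cont_on_dominated ltr01 _ (ACf _ _ ab) (ACf _ _ ab)) => u v _ _ _.
by rewrite mul1r -opprD normrN lerDl.
Qed.

Lemma locACB f g : locAC f -> locAC g -> locAC (fun x => f x - g x).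
Proof. by move=> ACf /locACN; exact: locACD. Qed.

Lemma locACM f g : locAC f -> locAC g -> locAC (fun x => f x * g x).
Proof.
move=> ACf ACg a b ab.
have [M M0 HM] := continuous_bounded a b (locAC_continuous ACf).
have [N N0 HN] := continuous_bounded a b (locAC_continuous ACg).
apply: (abs_cont_on_dominated (addr_gt0 M0 N0) _ (ACf _ _ ab) (ACg _ _ ab)) => u v au uv vb.
rewrite (_ : _ - _ = (f v - f u) * g v + f u * (g v - g u)); last by ring.
have fM : `|f u| <= M by rewrite HM// au (le_trans uv vb).
have gN : `|g v| <= N by rewrite HN// vb (le_trans au uv).
rewrite (le_trans (ler_normD _ _))// !normrM mulrDr lerD//.
  rewrite mulrC ler_wpM2r// (le_trans gN)// lerDr; exact: ltW.
rewrite ler_wpM2r// (le_trans fM)// lerDl; exact: ltW.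
Qed.

Lemma locAC_cst C : locAC (fun=> C).
Proof. by apply: (@locAC_lipschitz _ 0) => u v _; rewrite subrr normr0 mul0r. Qed.

End AbsolutelyContinuous.

(** * Primitives of locally integrable functions *)

Section Primitives.
Context {R : realType}.
Local Notation mu := (@lebesgue_measure R).
Implicit Types (f g h : R -> R) (a b C : R).

Lemma locally_integrable_itv f a b : locally_integrable setT f ->
  mu.-integrable `[a, b] (EFin \o f).
Proof.
move=> [mf _ If]; apply/integrableP; split.
  by apply/measurable_EFinP; exact: measurable_funTS.
by apply: If => //; exact: segment_compact.
Qed.

Lemma lebesgue_measure_itv_oc a b : a <= b -> mu `]a, b] = (b - a)%:E.
Proof.
rewrite lebesgue_measure_itv/= lte_fin le_eqVlt => /predU1P[->|->].
  by rewrite ltxx subrr.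
by rewrite EFinB.
Qed.

(** The oriented integral from 0 to [x]. The base point 0 is also where the initial values of
    differential systems are prescribed. *)
Definition prim f x : R :=
  if 0 <= x then \int[mu]_(t in `[0, x]) f t else - \int[mu]_(t in `[x, 0]) f t.

Lemma prim0 f : prim f 0 = 0.
Proof. by rewrite /prim lexx set_itv1 Rintegral_set1. Qed.

Lemma Rintegral_itv_cat f a b C : locally_integrable setT f -> a <= b -> b <= C ->
  \int[mu]_(t in `[a, C]) f t = \int[mu]_(t in `[a, b]) f t + \int[mu]_(t in `[b, C]) f t.
Proof.
move=> lf ab bc; rewrite -(@Rintegral_itv_obnd_cbnd R b (BRight C)); last first.
  by apply: integrableS (locally_integrable_itv b C lf) => //; exact: subset_itv_oc_cc.
rewrite -(@Rintegral_itvB _ _ (BLeft a) (BRight C) b) ?bnd_simp//; last exact: locally_integrable_itv.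
by rewrite addrC subrK.
Qed.

Lemma prim_sub f a b : locally_integrable setT f -> a <= b ->
  prim f b - prim f a = \int[mu]_(t in `[a, b]) f t.
Proof.
move=> lf ab; rewrite /prim.
case: leP => b0; case: leP => a0.
- by rewrite (Rintegral_itv_cat lf a0 ab) addrAC subrr add0r.
- by rewrite (Rintegral_itv_cat lf (ltW a0) b0) opprK addrC.
- by have := le_lt_trans (le_trans a0 ab) b0; rewrite ltxx.
- by rewrite (Rintegral_itv_cat lf ab (ltW b0)) opprK addrC addrK.
Qed.

(** The variation of [prim f] over finitely many intervals is at most the integral of |f| over their
    union, and that integral is small as soon as the measure of the union is. *)
Lemma prim_locAC f : locally_integrable setT f -> locAC (prim f).
Proof.
move=> lf a b ab e e0.
(* Restriction to [a, b] makes [f] integrable on the whole line, and all intervals considered lie in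
   [a, b]. *)
pose fab := f \_ `[a, b].
have ifab : mu.-integrable setT (EFin \o fab).
  by rewrite -restrict_EFin; apply/integrable_restrict => //=; rewrite setTI; exact: locally_integrable_itv.
have [d [d0 /= Hd]] := integral_normr_continuous ifab e0.
exists d => // n x y xy yx sd.
(* Half-open intervals remain disjoint when one begins where the previous one ends. *)
pose U k := \big[setU/set0]_(i < k) `]x i, y i]%classic.
have mU k : measurable (U k : set (measurableTypeR R)) by apply: bigsetU_measurable.
have muU k : (k <= n)%N -> (mu (U k) <= (\sum_(i < k) (y i - x i))%:E)%E.
  elim: k => [|k IHk] kn; first by rewrite /U !big_ord0 measure0.
  rewrite /U big_ord_recr/= -/(U k) big_ord_recr/= EFinD.
  apply: (le_trans (measureU2 mu (mU k) (measurable_itv `]x k, y k]))).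
  apply: leeD; first by rewrite IHk// ltnW.
  have [_ xyk _] := xy k kn.
  by rewrite [leLHS](lebesgue_measure_itv_oc xyk).
have UP k : (k <= n)%N -> \sum_(i < k) `|prim f (y i) - prim f (x i)| <= \int[mu]_(t in U k) `|fab t|.
  elim: k => [|k IHk] kn; first by rewrite /U !big_ord0 Rintegral_set0.
  have [axk xyk ykb] := xy k kn.
  rewrite /U big_ord_recr/= [in leRHS]big_ord_recr/= -/(U k).
  have iU : mu.-integrable (U k `|` `]x k, y k]%classic) (EFin \o (fun t => `|fab t|)).
    apply: (integrableS measurableT) => //; last by apply: integrable_norm ifab.
    exact: measurableU.
  have UkD : [disjoint U k & `]x k, y k]%classic].
    apply/disj_setPS => t [] /= Ut; rewrite in_itv/= => /andP[xkt _].
    move: Ut; rewrite /U -(bigcup_mkord k (fun i => `]x i, y i]%classic)) => -[i /= ik].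
    rewrite in_itv/= => /andP[_ tyi].
    have := yx i k ik kn; move=> /(le_trans tyi)/(lt_le_trans xkt).
    by rewrite ltxx.
  rewrite (Rintegral_setU (mU k) _ iU UkD)//.
  rewrite lerD//; first by rewrite IHk// ltnW.
  rewrite prim_sub//; apply: (le_trans (le_normr_Rintegral _ _)) => //.
    exact: locally_integrable_itv.
  have ixy : mu.-integrable `[x k, y k] (EFin \o (fun t => `|f t|)).
    exact: integrable_norm (locally_integrable_itv _ _ lf).
  rewrite -(@Rintegral_itv_obnd_cbnd R (x k) (BRight (y k)) (fun t => `|f t|)); last first.
    by apply: integrableS ixy => //; exact: subset_itv_oc_cc.
  rewrite le_eqVlt; apply/orP; left; apply/eqP; apply: eq_Rintegral => t.
  rewrite inE/= in_itv/= => /andP[xkt tyk].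
  rewrite /fab patchE mem_set//= in_itv/= (le_trans tyk ykb) andbT.
  by rewrite (le_trans axk)// ltW.
apply: (le_lt_trans (UP n (leqnn n))); apply: Hd => //.
by apply: (le_lt_trans (muU n (leqnn n))); rewrite lte_fin.
Qed.

(** Lebesgue's differentiation theorem gives the derivative at every Lebesgue point. Near [x] the
    primitive based at [x - 1] differs from [prim f] by a constant, which avoids distinguishing the
    sign of [x]. *)
Lemma prim_is_derive f : locally_integrable setT f ->
  {ae mu, forall x, is_derive x (1 : R) (prim f) (f x)}.
Proof.
move=> lf; have := lebesgue_differentiation lf.
apply: filterS; first exact: (ae_filter_ringOfSetsType mu).
move=> x fx.
have ix : mu.-integrable `[x - 1, x + 1] (EFin \o f) by exact: locally_integrable_itv.
have xx1 : x < x + 1 by rewrite ltrDl.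
have ax : (BLeft (x - 1)%R < BRight x)%E by rewrite /= lte_fin ltrBlDr ltrDl.
have [d1 d2] := FTC1_lebesgue_pt xx1 ix ax fx.
have D : is_derive x (1 : R) (fun y => \int[mu]_(t in `[x - 1, y]) f t) (f x).
  by rewrite -d2 derive1E; exact: derivableP.
have {}D := is_deriveD D (is_derive_cst (prim f (x - 1)) x (1 : R)).
rewrite addr0 in D.
apply: near_eq_is_derive D; near=> y.
rewrite !fctE/= -(prim_sub lf) ?subrK//.
near: y; exists 1 => [|y]; first exact: ltr01.
rewrite /ball_/= => /ltr_normlP[? ?]; lra.
Unshelve. all: by end_near. Qed.

End Primitives.

(** * The fundamental theorem of calculus for absolutely continuous functions *)

Section FundamentalTheorem.
Context {R : realType}.
Local Notation mu := (@lebesgue_measure R).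
Implicit Types (f g h : R -> R) (a b C : R).

Lemma ae_imp (P W : R -> Prop) : {ae mu, forall x, P x} ->
  (forall x, P x -> W x) -> {ae mu, forall x, W x}.
Proof.
by move=> p w; apply: filterS p => //; exact: (ae_filter_ringOfSetsType mu).
Qed.

Lemma ae_imp2 (P Q W : R -> Prop) : {ae mu, forall x, P x} ->
  {ae mu, forall x, Q x} -> (forall x, P x -> Q x -> W x) ->
  {ae mu, forall x, W x}.
Proof.
by move=> p q w; apply: filterS2 p q => //; exact: (ae_filter_ringOfSetsType mu).
Qed.

(** Compactness of [a, b] in the form of Cousin's lemma, with a transitive relation in place of
    tagged partitions: [G u v] is to say what a fine partition of [u, v] provides. The supremum of
    the points reachable from [a] could be passed if [b] were not within reach. *)
Lemma cousin (G : R -> R -> Prop) a b : a <= b ->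
  (forall u v w, G u v -> G v w -> G u w) ->
  (forall x, a <= x <= b -> exists2 d, 0 < d & forall u v, a <= u -> u <= x ->
     x <= v -> v <= b -> x - d < u -> v < x + d -> G u v) ->
  G a b.
Proof.
move=> ab Gtrans Gloc.
pose S := [set x | a <= x <= b /\ G a x].
have Sa : S a.
  split; first by rewrite lexx.
  have [|d d0] := Gloc a; first by rewrite lexx.
  by apply => //; [rewrite ltrBlDr ltrDl|rewrite ltrDl].
have supS : has_sup S by split; [exists a|exists b => x [/andP[]]].
pose c := sup S.
have ac : a <= c by exact: (sup_upper_bound supS).
have cb : c <= b by apply: ge_sup; [exists a|move=> x [/andP[]]].
have [|d d0 Hd] := Gloc c; first by rewrite ac.
have [u [/andP[au ub] Gau] cdu] := sup_adherent d0 supS.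
have uc : u <= c by apply: (sup_upper_bound supS); split => //; rewrite au.
have Gext v : c <= v -> v <= b -> v < c + d -> S v.
  move=> cv vb vcd; split; first by rewrite (le_trans ac cv).
  by apply: (Gtrans _ _ _ Gau); exact: Hd.
have [bcd|cdb] := ltP b (c + d / 2).
  by have [] : S b by apply: Gext => //; lra.
have Scd : S (c + d / 2) by apply: Gext => //; lra.
have : c + d / 2 <= c by exact: (sup_upper_bound supS).
by move=> ?; lra.
Qed.

Lemma is_derive0_near f x e : is_derive x (1 : R) f 0 -> 0 < e ->
  exists2 d, 0 < d & forall y, `|x - y| < d -> `|f y - f x| <= e * `|y - x|.
Proof.
move=> fx e0; have := @derive_val _ _ _ _ _ _ _ fx => fx0.
have : derivable f x 1 by exact: (@ex_derive _ _ _ _ _ _ _ fx).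
rewrite /derivable; move: fx0; rewrite /derive => -> /cvgrPdist_lt/(_ e e0).
move=> [d /= d0 Hd]; exists d => // y xyd.
have [->|yx] := eqVneq y x; first by rewrite !subrr normr0 mulr0.
have yx0 : y - x != 0 by rewrite subr_eq0.
have := Hd (y - x); rewrite /ball_/= sub0r normrN distrC => /(_ xyd yx0).
rewrite sub0r normrN [_ *: 1]mulr1 subrK normrZ normfV => /ltW.
by rewrite mulrC ler_pdivrMr ?normr_gt0// distrC.
Qed.

(* A tagged partition fine for both requirements splits [a, b] into intervals on
   which f grows at rate at most e and intervals covered by an open set of small
   measure, on which absolute continuity bounds the total variation. *)
Lemma locAC_is_derive0 f a b : locAC f -> {ae mu, forall x, is_derive x (1 : R) f 0} ->
  a <= b -> f b = f a.
Proof.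
move=> ACf [N [mN N0 HN]] ab.
suff Hle e : 0 < e -> `|f b - f a| <= e * (b - a) + e.
  apply/eqP; rewrite -subr_eq0 -normr_le0; apply/ler_addgt0Pl => e e0.
  have ba0 : 0 < b - a + 1 by rewrite ltr_wpDl// subr_ge0.
  apply: (le_trans (Hle (e / (b - a + 1)) _)); first by rewrite divr_gt0.
  rewrite addr0 le_eqVlt; apply/orP; left; apply/eqP; field.
  by rewrite gt_eqF.
move=> e0; have [d d0 Hd] := ACf _ _ ab _ e0.
have muN : (mu N < +oo)%E by rewrite [mu N]N0.
have [U [oU NU UN]] := lebesgue_regularity_outer mN muN d0.
have mU : measurable (U : set (measurableTypeR R)) by exact: open_measurable.
have muU : (mu U < d%:E)%E.
  rewrite (_ : U = N `|` (U `\` N)); last by rewrite setDUK.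
  apply: (le_lt_trans (measureU2 mu mN (measurableD mU mN))).
  by rewrite [X in (X + _)%E]N0 add0e.
pose wf (u v : R) (s : seq (R * R)) :=
  (all (fun p => [&& u <= p.1, p.1 <= p.2 & p.2 <= v]) s) &&
  pairwise (fun p p' => p.2 <= p'.1) s.
(* The list [s] collects the intervals covered by [U]. Their total length is compared with the
   measure of [U] in ]u, v] rather than with [d], since that bound adds up under concatenation;
   absolute continuity is applied only once, to the final list. *)
pose G u v := u <= v /\ exists s : seq (R * R), [/\ wf u v s,
  ((\sum_(p <- s) (p.2 - p.1))%:E <= mu (U `&` `]u, v]))%E &
  `|f v - f u| <= e * (v - u) + \sum_(p <- s) `|f p.2 - f p.1| ].
have Gtrans u v w : G u v -> G v w -> G u w.
  move=> [uv [s [/andP[sA sP] ms fs]]] [vw [t [/andP[tA tP] mt ft]]].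
  split; first exact: (le_trans uv).
  exists (s ++ t); split.
  - rewrite /wf all_cat pairwise_cat sP tP !andbT; apply/andP; split.
      apply/andP; split.
        by apply: sub_all sA => p /and3P[-> ->] /le_trans ->.
      by apply: sub_all tA => p /and3P[/(le_trans uv) -> -> ->].
    apply/allrelP => p p' /(allP sA)/and3P[_ _ pv] /(allP tA)/and3P[vp _ _].
    exact: (le_trans pv).
  - rewrite big_cat/= EFinD.
    rewrite (_ : `]u, w]%classic = `]u, v] `|` `]v, w]); last first.
      by rewrite -itv_bndbnd_setU// bnd_simp.
    rewrite setIUr measureU ?leeD//; [exact: measurableI|exact: measurableI|].
    rewrite -subset0 => z [[_ /=] + [_ /=]].
    by rewrite !in_itv/= => /andP[_ zv] /andP[/(le_lt_trans zv)]; rewrite ltxx.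
  - rewrite big_cat/= (_ : f w - f u = (f w - f v) + (f v - f u)); last by ring.
    apply: (le_trans (ler_normD _ _)).
    by move: fs ft; lra.
have [ab' [s [/andP[sA sP] ms fs]]] : G a b.
  apply: cousin => // x axb.
  have [xN|xN] := pselect (N x).
    have [r /= r0 Hr] := oU x (NU x xN).
    exists r => // u v au ux xv vb xru vxr; split; first exact: (le_trans ux).
    have uv := le_trans ux xv.
    exists [:: (u, v)]; split.
    - by rewrite /wf/= !lexx uv.
    - rewrite big_seq1/= (_ : U `&` _ = `]u, v]%classic); last first.
        apply/setIidr => z /=; rewrite in_itv/= => /andP[uz zv].
        by apply: Hr; rewrite /ball_/= ltr_norml; apply/andP; split; lra.
      by rewrite [leRHS](lebesgue_measure_itv_oc uv).
    - by rewrite big_seq1/= lerDr mulr_ge0 ?subr_ge0// ltW.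
  have fx0 : is_derive x (1 : R) f 0 by apply: contrapT => nf; exact/xN/HN.
  have [r r0 Hr] := is_derive0_near fx0 e0.
  exists r => // u v au ux xv vb xru vxr; split; first exact: (le_trans ux).
  exists [::]; split => //; first by rewrite big_nil.
  rewrite big_nil addr0 (_ : f v - f u = (f v - f x) + - (f u - f x)); last by ring.
  apply: (le_trans (ler_normD _ _)); rewrite normrN.
  have Hv : `|f v - f x| <= e * (v - x).
    by rewrite -[v - x]ger0_norm ?subr_ge0//; apply: Hr; rewrite ltr_norml; lra.
  have Hu : `|f u - f x| <= e * (x - u).
    rewrite -[x - u]ger0_norm ?subr_ge0// [`|x - u|]distrC; apply: Hr.
    by rewrite ltr_norml; lra.
  by move: Hv Hu; lra.
apply: (le_trans fs); rewrite lerD2l ltW//.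
pose x k := (nth (0, 0) s k).1; pose y k := (nth (0, 0) s k).2.
rewrite (big_nth (0, 0)) big_mkord; apply: (Hd _ x y).
- move=> k ks; have /(allP sA) := mem_nth (0, 0) ks.
  by move=> /and3P.
- move=> j k jk ks; have /(pairwiseP (0, 0)) := sP; apply => //.
  exact: ltn_trans ks.
- move: ms; rewrite (big_nth (0, 0)) big_mkord -lte_fin => /le_lt_trans; apply.
  apply: le_lt_trans muU; apply: le_measure; rewrite ?inE//.
  exact: measurableI.
Qed.

(** [f - prim g] is locally absolutely continuous with derivative zero almost everywhere, hence
    constant. *)
Lemma locAC_prim f g : locAC f -> locally_integrable setT g ->
  {ae mu, forall x, is_derive x (1 : R) f (g x)} ->
  forall x y, f y - f x = prim g y - prim g x.
Proof.
move=> ACf lg fg.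
have H x y : x <= y -> f y - prim g y = f x - prim g x.
  apply: (@locAC_is_derive0 (fun x => f x - prim g x)).
    by apply: locACB => //; exact: prim_locAC.
  apply: (ae_imp2 fg (prim_is_derive lg)) => z fz gz.
  by have := is_deriveB fz gz; rewrite subrr.
move=> x y; have [/H|/ltW/H] := leP x y; lra.
Qed.

End FundamentalTheorem.

(** * Calculus of locally integrable functions and their primitives *)

Section LocallyIntegrable.
Context {R : realType}.
Local Notation mu := (@lebesgue_measure R).
Implicit Types (f g h : R -> R) (a b C : R).

Lemma locally_integrable_measurable f : locally_integrable setT f -> measurable_fun setT f.
Proof. by case. Qed.

Lemma locally_integrable_ext f g : f =1 g -> locally_integrable setT f ->
  locally_integrable setT g.
Proof. by move=> /funext ->. Qed.

(** The factor may depend on the compact set, which is what multiplication by a continuous function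
    requires. *)
Lemma locally_integrable_dominated f g C : measurable_fun setT f ->
  locally_integrable setT g ->
  (forall K, compact K -> exists M : R, forall x, K x -> `|f x| <= M * `|g x|) ->
  locally_integrable setT f.
Proof.
move=> mf [mg oT Ig] fg; split => // K _ cK.
have [M HM] := fg K cK.
have mK : measurable (K : set (measurableTypeR R)) by exact: compact_measurable.
have ig : mu.-integrable K (EFin \o (fun x => M * g x)).
  have -> : EFin \o (fun x => M * g x) = (fun x => M%:E * (EFin \o g) x)%E by [].
  apply: integrableZl => //; apply/integrableP; split; last exact: Ig.
  by apply/measurable_EFinP; exact: measurable_funTS.
have : mu.-integrable K (EFin \o f).
  apply: le_integrable ig => //.
    by apply/measurable_EFinP; exact: measurable_funTS.
  move=> x Kx /=; rewrite lee_fin normrM (le_trans (HM x Kx))//.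
  by rewrite ler_wpM2r// ler_norm.
by case/integrableP.
Qed.

Lemma locally_integrableMc f g : locally_integrable setT f -> continuous g ->
  locally_integrable setT (fun x => f x * g x).
Proof.
move=> lf cg; have [mf _ _] := lf.
apply: (locally_integrable_dominated 0 _ lf).
  by apply: measurable_funM => //; exact: continuous_measurable_fun.
move=> K cK.
have : compact (g @` K).
  by apply: continuous_compact => //; exact: continuous_subspaceT.
move=> /compact_bounded[M [_ HM]]; exists (M + 1) => x Kx.
rewrite normrM mulrC ler_wpM2r//; apply: (HM (M + 1)); first by rewrite ltrDl.
by exists x.
Qed.

Lemma continuous_locally_integrable f : continuous f -> locally_integrable setT f.
Proof.
move=> cf; apply: locally_integrable_ext (locally_integrableMc (f := cst 1) _ cf).
  by move=> x /=; rewrite mul1r.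
apply: locally_integrable_ext (locally_integrable_indic openT measurableT).
by move=> x; rewrite indicT.
Qed.

Lemma locally_integrable_sum (m : nat) (F : 'I_m -> R -> R) :
  (forall i, locally_integrable setT (F i)) ->
  locally_integrable setT (fun x => \sum_(i < m) F i x).
Proof.
elim: m F => [|m IHm] F lF.
  apply: (@locally_integrable_ext (cst 0)); first by move=> x; rewrite big_ord0.
  by apply: continuous_locally_integrable; exact: cst_continuous.
have := locally_integrableD (IHm _ (fun i => lF (widen_ord (leqnSn m) i))) (lF ord_max).
by apply: locally_integrable_ext => x; rewrite big_ord_recr.
Qed.

Lemma locally_integrable_norm f : locally_integrable setT f ->
  locally_integrable setT (fun x => `|f x|).
Proof.
move=> [mf oT If]; split => //; first exact: measurableT_comp.
by move=> K KT cK; under eq_integral do rewrite normr_id; exact: If.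
Qed.

(** In this form, a sign times one integral, linearity and estimates need no case distinction on the
    sign of [x]. *)
Lemma primE f x : prim f x = (if 0 <= x then 1 else -1) *
  \int[mu]_(t in `[Num.min 0 x, Num.max 0 x]) f t.
Proof.
by rewrite /prim; case: (leP 0 x) => _; rewrite ?mul1r// mulN1r.
Qed.

Lemma primD f g x : locally_integrable setT f -> locally_integrable setT g ->
  prim (fun t => f t + g t) x = prim f x + prim g x.
Proof.
move=> lf lg; rewrite !primE RintegralD// ?mulrDr//.
- exact: locally_integrable_itv.
- exact: locally_integrable_itv.
Qed.

Lemma primZ f C x : locally_integrable setT f ->
  prim (fun t => C * f t) x = C * prim f x.
Proof.
move=> lf; rewrite !primE RintegralZl//; first by rewrite mulrCA.
exact: locally_integrable_itv.
Qed.

Lemma eq_prim f g x : (forall t, Num.min 0 x <= t <= Num.max 0 x -> f t = g t) ->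
  prim f x = prim g x.
Proof.
move=> fg; rewrite !primE; congr (_ * _); apply: eq_Rintegral => t.
by rewrite inE/= in_itv/= => /fg.
Qed.

Lemma le_norm_prim f g x : locally_integrable setT f -> locally_integrable setT g ->
  (forall t, `|f t| <= g t) -> `|prim f x| <= `|prim g x|.
Proof.
move=> lf lg fg; rewrite !primE !normrM ler_wpM2l//.
apply: (le_trans (le_normr_Rintegral _ _)) => //.
  exact: locally_integrable_itv.
apply: (le_trans _ (ler_norm _)); apply: le_Rintegral => //.
- by apply: integrable_norm; exact: locally_integrable_itv.
- exact: locally_integrable_itv.
Qed.

(** The passage to the limit in the Picard iteration. The limit inherits the majorant [g], whence
    its local integrability. *)
Lemma prim_dominated_cvg (F : nat -> R -> R) f g x :
  (forall n, locally_integrable setT (F n)) -> locally_integrable setT g ->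
  (forall t, F ^~ t @ \oo --> f t) -> (forall n t, `|F n t| <= g t) ->
  locally_integrable setT f /\ prim (F n) x @[n --> \oo] --> prim f x.
Proof.
move=> lF lg Ff Fg.
have mf : measurable_fun setT f.
  apply: (@measurable_fun_cvg _ _ _ _ F) => [n|t _]; last exact: Ff.
  exact: locally_integrable_measurable.
have fg t : `|f t| <= g t.
  have cF : (fun n => `|F n t|) @ \oo --> `|f t| by apply: cvg_norm; exact: Ff.
  rewrite -(cvg_lim (@Rhausdorff R) cF); apply: limr_le; first exact: cvgP cF.
  by apply: nearW => n; exact: Fg.
have lf : locally_integrable setT f.
  apply: (locally_integrable_dominated 0 mf lg) => K _; exists 1 => t _.
  by rewrite mul1r (le_trans (fg t))// ler_norm.
split => //; rewrite primE.
under eq_fun do rewrite primE.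
apply: cvgM; first exact: cvg_cst.
set I := [set` _].
have mI : measurable (I : set (measurableTypeR R)) by exact: measurable_itv.
have lI h : locally_integrable setT h -> mu.-integrable I (EFin \o h).
  by move=> lh; exact: locally_integrable_itv.
apply: fine_cvg; rewrite fineK; last exact: integrable_fin_num (lI _ lf).
apply: (@dominated_cvg _ _ _ mu I mI (fun n => EFin \o F n) _ (EFin \o g)).
- by move=> n; apply: measurable_int (lI _ (lF n)).
- by move=> t _; apply/fine_cvgP; split; [exact: nearW|exact: Ff].
- by [].
- exact: lI.
- by move=> n t _; rewrite lee_fin.
Qed.

(** With P = [prim f], the function P^(n+1) / (n+1) is locally absolutely continuous with derivative
    f P^n almost everywhere. This is the induction step that puts a factorial into the Picard
    estimate; the absolute values account for P <= 0 to the left of 0. *)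
Lemma norm_prim_expn f n x : locally_integrable setT f -> (forall t, 0 <= f t) ->
  `|prim (fun t => f t * `|prim f t| ^+ n) x| = `|prim f x| ^+ n.+1 / n.+1%:R.
Proof.
move=> lf f0.
have ACf := prim_locAC lf; have cf := locAC_continuous ACf.
have ACX k : locAC (fun t => prim f t ^+ k).
  elim: k => [|k IHk]; first by under eq_fun do rewrite expr0; exact: locAC_cst.
  suff -> : (fun t => prim f t ^+ k.+1) = (fun t => prim f t * prim f t ^+ k) by exact: locACM.
  by apply/funext => t; rewrite exprS.
have lX k : locally_integrable setT (fun t => f t * prim f t ^+ k).
  by apply: locally_integrableMc => //; exact: locAC_continuous.
have E : prim (fun t => f t * prim f t ^+ n) x = prim f x ^+ n.+1 / n.+1%:R.
  have AC1 : locAC (fun t => n.+1%:R^-1 * prim f t ^+ n.+1).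
    by apply: locACM => //; exact: locAC_cst.
  have D : {ae mu, forall t, is_derive t (1 : R)
      (fun t => n.+1%:R^-1 * prim f t ^+ n.+1) (f t * prim f t ^+ n)}.
    apply: (ae_imp (prim_is_derive lf)) => t ft.
    have := is_deriveZ n.+1%:R^-1 (is_deriveX n.+1 ft).
    rewrite (_ : _ \*: _ = fun t => n.+1%:R^-1 * prim f t ^+ n.+1); last first.
      by apply/funext => u /=; rewrite exprfctE.
    move=> /is_derive_eq; apply; rewrite /GRing.scale/= !mulrA mulVf ?pnatr_eq0//.
    by rewrite mul1r mulrC.
  have := locAC_prim AC1 (lX n) D 0 x; rewrite !prim0 expr0n mulr0 !subr0 => <-.
  by rewrite mulrC.
have [x0|x0] := leP 0 x.
  rewrite (@eq_prim _ (fun t => f t * prim f t ^+ n)) ?E.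
    by rewrite normrM normrX (ger0_norm (x := _^-1)).
  move=> t; rewrite (min_idPl x0) (max_idPr x0) => /andP[t0 _].
  by rewrite ger0_norm// /prim t0 Rintegral_ge0.
rewrite (@eq_prim _ (fun t => (-1) ^+ n * (f t * prim f t ^+ n))).
  by rewrite primZ// E normrM normrX normrN1 expr1n mul1r normrM normrX (ger0_norm (x := _^-1)).
move=> t; rewrite (min_idPr (ltW x0)) (max_idPl (ltW x0)) => /andP[_ t0].
have : prim f t <= 0.
  move: t0; rewrite le_eqVlt => /predU1P[->|t0]; first by rewrite prim0.
  by rewrite /prim (leNgt 0 t) t0/= oppr_le0 Rintegral_ge0.
by move=> /ler0_norm ->; rewrite [(- prim f t) ^+ n]exprNn mulrCA.
Qed.

End LocallyIntegrable.

(** * Linear differential equations with locally integrable coefficients *)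

Section LinearODE.
Context {R : realType}.
Local Notation mu := (@lebesgue_measure R).

Lemma series_exp_coeff_le (y : R) k : 0 <= y -> series (exp_coeff y) k <= expR y.
Proof.
move=> y0; apply: nondecreasing_cvgn_le; last exact: is_cvg_series_exp_coeff.
by apply: nondecreasing_series => n _ _; exact: exp_coeff_ge0.
Qed.

Lemma cvg_sum_ord (m : nat) (F : 'I_m -> nat -> R) (l : 'I_m -> R) :
  (forall i, F i @ \oo --> l i) ->
  (fun k => \sum_(i < m) F i k) @ \oo --> \sum_(i < m) l i.
Proof.
elim: m F l => [|m IHm] F l Fl.
  by rewrite big_ord0; under eq_fun do rewrite big_ord0; exact: cvg_cst.
rewrite big_ord_recr; under eq_fun do rewrite big_ord_recr.
by apply: cvgD; [exact: (IHm (fun i => F (widen_ord (leqnSn m) i)))|exact: Fl].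
Qed.

(** Picard iteration, with terms dominated by those of an exponential series in the integral of the
    coefficients. The series converges at every real point, so the solution is global without
    gluing. *)
Theorem linear_ode_solution (m : nat) (A : 'I_m -> 'I_m -> R -> R) (c : 'I_m -> R) :
  (forall i j, locally_integrable setT (A i j)) ->
  exists X : 'I_m -> R -> R, forall i, [/\ locAC (X i), X i 0 = c i &
    {ae mu, forall x, is_derive x (1 : R) (X i) (\sum_(j < m) A i j x * X j x)}].
Proof.
move=> lA.
pose T (Y : 'I_m -> R -> R) i := prim (fun t => \sum_(j < m) A i j t * Y j t).
(* By linearity the n-th difference of Picard iterates is [T] applied n times to the constant
   function [c]: the solution is a sum of iterated integrals, the Peano-Baker series. *)
pose D n := iter n T (fun i _ => c i).
have lAY Y : (forall j, locAC (Y j)) -> forall i,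
    locally_integrable setT (fun t => \sum_(j < m) A i j t * Y j t).
  move=> ACY i; apply: locally_integrable_sum => j.
  by apply: locally_integrableMc => //; exact: locAC_continuous.
have ACD n i : locAC (D n i).
  elim: n i => [|n IHn] i; first exact: locAC_cst.
  by apply: prim_locAC; exact: lAY.
(* The sum of all entries in absolute value bounds every row at once. *)
pose N t := \sum_(i < m) \sum_(j < m) `|A i j t|.
have lN : locally_integrable setT N.
  do 2 apply: locally_integrable_sum => ?; exact: locally_integrable_norm.
have N0 t : 0 <= N t by do 2 apply: sumr_ge0 => ? _.
have AN (Y : 'I_m -> R -> R) K i t : (forall j, `|Y j t| <= K) ->
    `|\sum_(j < m) A i j t * Y j t| <= N t * K.
  move=> YK; rewrite (le_trans (ler_norm_sum _ _ _))//.
  apply: (@le_trans _ _ (\sum_(j < m) `|A i j t| * K)).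
    by apply: ler_sum => j _; rewrite normrM ler_wpM2l.
  have K0 : 0 <= K.
    exact: le_trans (normr_ge0 _) (YK i).
  rewrite -mulr_suml ler_wpM2r// /N [leRHS](bigD1 i)//= lerDl.
  by do 2 apply: sumr_ge0 => ? _.
pose Q := prim N; pose C := \sum_(i < m) `|c i|.
have cQ : continuous (fun t => `|Q t|).
  move=> t; apply: continuous_comp; last exact: norm_continuous.
  exact: (locAC_continuous (prim_locAC lN)).
have lNQ n : locally_integrable setT (fun t => N t * `|prim N t| ^+ n).
  apply: locally_integrableMc => // t.
  apply: (@continuous_comp R R R (fun t => `|Q t|) (fun u => u ^+ n)); first exact: cQ.
  exact: exprn_continuous.
have C0 : 0 <= C by apply: sumr_ge0.
have DQ n i x : `|D n i x| <= C * exp_coeff `|Q x| n.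
  rewrite exp_coeffE; elim: n i x => [|n IHn] i x.
    rewrite /= expr0 fact0 invr1 !mulr1 /C (bigD1 i)//= lerDl.
    by apply: sumr_ge0.
  apply: (@le_trans _ _ `|prim (fun t => (C / n`!%:R) * (N t * `|prim N t| ^+ n)) x|).
    apply: le_norm_prim => [||t].
    - exact: lAY.
    - have := locally_integrableMc (lNQ n) (@cst_continuous _ _ (C / n`!%:R)).
      by apply: locally_integrable_ext => t; rewrite mulrC.
    - rewrite (_ : C / _ * _ = N t * (C * (n`!%:R^-1 * `|Q t| ^+ n))).
        by apply: AN => j; exact: IHn.
      by rewrite -/Q; ring.
  rewrite primZ//.
  rewrite normrM norm_prim_expn// ger0_norm ?divr_ge0// factS natrM invfM /=.
  by rewrite -/Q le_eqVlt; apply/orP; left; apply/eqP; ring.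
pose X i x := limn (series (fun n => D n i x)).
have SX i x : series (fun n => D n i x) @ \oo --> X i x.
  apply: normed_cvg.
  apply: (@series_le_cvg _ _ (fun n => C * exp_coeff `|Q x| n)).
  - by move=> n; exact: normr_ge0.
  - by move=> n; rewrite mulr_ge0// exp_coeff_ge0.
  - by move=> n; exact: DQ.
  - by apply: is_cvg_seriesZ; exact: is_cvg_series_exp_coeff.
pose S k i x := series (fun n => D n i x) k.
have Sle k i x : `|S k i x| <= C * expR `|Q x|.
  rewrite /S /series/= (le_trans (ler_norm_sum _ _ _))//.
  apply: (@le_trans _ _ (\sum_(0 <= n < k) C * exp_coeff `|Q x| n)).
    by apply: ler_sum => n _; exact: DQ.
  by rewrite -mulr_sumr ler_wpM2l// series_exp_coeff_le.
have ACS k i : locAC (S k i).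
  rewrite /S /series/=; elim: k => [|k IHk].
    by under eq_fun do rewrite big_geq//; exact: locAC_cst.
  suff -> : (fun x => \sum_(0 <= n < k.+1) D n i x) =
    (fun x => \sum_(0 <= n < k) D n i x + D k i x) by exact: locACD.
  by apply/funext => x; rewrite big_nat_recr.
(* The partial sums are the Picard iterates themselves; the limit of this recursion is the integral
   equation. *)
have SE k i x : S k.+1 i x = c i + prim (fun t => \sum_(j < m) A i j t * S k j t) x.
  elim: k => [|k IHk].
    rewrite /S /series/= big_nat1 (@eq_prim _ _ (fun=> 0)).
      by rewrite primE Rintegral_cst// mul0r mulr0 addr0.
    by move=> t _; rewrite big1// => j _; rewrite big_geq// mulr0.
  rewrite [LHS]/S seriesSr/= -/(S k.+1 i x) IHk -addrA; congr (_ + _).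
  rewrite -/(T (D k) i) -primD; [|exact: lAY|exact: lAY].
  apply: eq_prim => t _; rewrite -big_split/=; apply: eq_bigr => j _.
  by rewrite -mulrDr /S [in RHS]seriesSr.
have XE i x : locally_integrable setT (fun t => \sum_(j < m) A i j t * X j t) /\
    X i x = c i + prim (fun t => \sum_(j < m) A i j t * X j t) x.
  have [||||lX cX] := @prim_dominated_cvg _ (fun k t => \sum_(j < m) A i j t * S k j t)
    (fun t => \sum_(j < m) A i j t * X j t) (fun t => N t * (C * expR `|Q t|)) x.
  - by move=> k; apply: lAY => j; exact: ACS.
  - apply: locally_integrableMc => // t; apply: cvgMl_tmp.
    apply: (@continuous_comp R R R (fun t => `|Q t|) expR); first exact: cQ.
    exact: continuous_expR.
  - move=> t; apply: cvg_sum_ord => j; apply: cvgMl_tmp; exact: SX.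
  - by move=> k t; apply: AN => j; exact: Sle.
  split => //.
  have c1 : (fun k => S k.+1 i x) @ \oo --> X i x.
    by rewrite (cvg_shiftS (fun k => S k i x)); exact: SX.
  have c2 : (fun k => S k.+1 i x) @ \oo --> c i + prim (fun t => \sum_(j < m) A i j t * X j t) x.
    by under eq_fun do rewrite SE; apply: cvgD => //; exact: cvg_cst.
  exact: (cvg_unique _ c1 c2).
have XEf i : X i = (fun x => c i + prim (fun t => \sum_(j < m) A i j t * X j t) x).
  by apply/funext => x; have [] := XE i x.
exists X => i; have [lX _] := XE i 0; split.
- by rewrite XEf; apply: locACD; [exact: locAC_cst|exact: prim_locAC].
- by rewrite XEf prim0 addr0.
- apply: (ae_imp (prim_is_derive lX)) => x dx; rewrite [X in is_derive _ _ X _]XEf.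
  by have := is_deriveD (is_derive_cst (c i) x (1 : R)) dx; rewrite add0r.
Qed.

End LinearODE.

(** * Complex-valued functions of a real variable *)

Section ComplexValued.
Context {R : realType}.
Local Notation mu := (@lebesgue_measure R).
Local Notation C := (R[i]).
Implicit Types (f g : R -> C) (z w : C).

Lemma cReD z w : complex.Re (z + w) = complex.Re z + complex.Re w.
Proof. by case: z; case: w. Qed.
Lemma cImD z w : complex.Im (z + w) = complex.Im z + complex.Im w.
Proof. by case: z; case: w. Qed.
Lemma cReN z : complex.Re (- z) = - complex.Re z. Proof. by case: z. Qed.
Lemma cImN z : complex.Im (- z) = - complex.Im z. Proof. by case: z. Qed.
Lemma cReM z w : complex.Re (z * w) =
  complex.Re z * complex.Re w - complex.Im z * complex.Im w.
Proof. by case: z; case: w. Qed.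
Lemma cImM z w : complex.Im (z * w) =
  complex.Re z * complex.Im w + complex.Im z * complex.Re w.
Proof. by case: z; case: w. Qed.
Lemma cReJ z : complex.Re z^* = complex.Re z. Proof. by case: z. Qed.
Lemma cImJ z : complex.Im z^* = - complex.Im z. Proof. by case: z. Qed.
Lemma cRei : complex.Re ('i : C) = 0. Proof. by rewrite -complexiE. Qed.
Lemma cImi : complex.Im ('i : C) = 1. Proof. by rewrite -complexiE. Qed.
Lemma cRe0 : complex.Re (0 : C) = 0. Proof. by []. Qed.
Lemma cIm0 : complex.Im (0 : C) = 0. Proof. by []. Qed.
Lemma cRe1 : complex.Re (1 : C) = 1. Proof. by []. Qed.
Lemma cIm1 : complex.Im (1 : C) = 0. Proof. by []. Qed.
Lemma cReR (x : R) : complex.Re (x%:C)%C = x. Proof. by []. Qed.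
Lemma cImR (x : R) : complex.Im (x%:C)%C = 0. Proof. by []. Qed.

Definition reim := (cReD, cImD, cReN, cImN, cReM, cImM, cReJ, cImJ, cRei, cImi,
  cRe0, cIm0, cRe1, cIm1, cReR, cImR).

Lemma complex_eqP z w : complex.Re z = complex.Re w -> complex.Im z = complex.Im w -> z = w.
Proof. by case: z w => a b [a' b'] /= -> ->. Qed.

Lemma conjcD z w : (z + w)^* = z^* + w^*. Proof. exact: rmorphD. Qed.
Lemma conjcM z w : (z * w)^* = z^* * w^*. Proof. exact: rmorphM. Qed.
Lemma conjcN z : (- z)^* = - z^*. Proof. exact: rmorphN. Qed.
Lemma conjcR (x : R) : ((x%:C)%C : C)^* = (x%:C)%C.
Proof. by apply: complex_eqP; rewrite ?(cReJ, cImJ)//= oppr0. Qed.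
Lemma mulcii : 'i * 'i = -1 :> C. Proof. by rewrite -expr2 sqrCi. Qed.

Definition conjcE := (conjcD, conjcM, conjcN, @conjCK C, @conjCi C, conjcR).

Definition clocAC f :=
  locAC (fun x => complex.Re (f x)) /\ locAC (fun x => complex.Im (f x)).
(** Differentiability and the value of the derivative in one predicate, so that the rules for sums,
    products and conjugates compose; [cderiveP] translates back to the form used in [Dmax]. *)
Definition cderiv f x (l : C) :=
  is_derive x (1 : R) (fun t => complex.Re (f t)) (complex.Re l) /\
  is_derive x (1 : R) (fun t => complex.Im (f t)) (complex.Im l).
Definition cprim f x : C :=
  complex.Complex (prim (fun t => complex.Re (f t)) x) (prim (fun t => complex.Im (f t)) x).

Lemma cderiveP f x l : cderiv f x l <-> cderivable f x /\ cderive f x = l.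
Proof.
split=> [[dr di]|[[dr di] <-]]; last first.
  by split; rewrite /cderive/= derive1E; exact: derivableP.
split; first by split; [exact: (@ex_derive _ _ _ _ _ _ _ dr)|exact: (@ex_derive _ _ _ _ _ _ _ di)].
by apply: complex_eqP => /=; rewrite derive1E derive_val.
Qed.

Lemma eq_locAC (h k : R -> R) : h =1 k -> locAC h -> locAC k.
Proof. by move=> /funext ->. Qed.

Lemma eq_is_derive (h k : R -> R) x (l l' : R) : h =1 k -> l = l' ->
  is_derive x (1 : R) h l -> is_derive x (1 : R) k l'.
Proof. by move=> /funext -> ->. Qed.

Lemma clocACD f g : clocAC f -> clocAC g -> clocAC (fun x => f x + g x).
Proof.
move=> [fr fi] [gr gi]; split.
  by apply: eq_locAC (locACD fr gr) => x; rewrite reim.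
by apply: eq_locAC (locACD fi gi) => x; rewrite reim.
Qed.

Lemma clocACN f : clocAC f -> clocAC (fun x => - f x).
Proof.
move=> [fr fi]; split.
  by apply: eq_locAC (locACN fr) => x; rewrite reim.
by apply: eq_locAC (locACN fi) => x; rewrite reim.
Qed.

Lemma clocACM f g : clocAC f -> clocAC g -> clocAC (fun x => f x * g x).
Proof.
move=> [fr fi] [gr gi]; split.
  by apply: eq_locAC (locACB (locACM fr gr) (locACM fi gi)) => x; rewrite !reim.
by apply: eq_locAC (locACD (locACM fr gi) (locACM fi gr)) => x; rewrite !reim.
Qed.

Lemma clocACJ f : clocAC f -> clocAC (fun x => (f x)^*).
Proof.
move=> [fr fi]; split.
  by apply: eq_locAC fr => x; rewrite reim.
by apply: eq_locAC (locACN fi) => x; rewrite reim.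
Qed.

Lemma clocAC_cst z : clocAC (fun=> z).
Proof. by split; exact: locAC_cst. Qed.

Lemma clocACR (h : R -> R) : locAC h -> clocAC (fun x => (h x)%:C)%C.
Proof. by move=> ach; split => //; exact: locAC_cst. Qed.

Lemma cderivD f g x k l : cderiv f x k -> cderiv g x l ->
  cderiv (fun t => f t + g t) x (k + l).
Proof.
move=> [fr fi] [gr gi]; split.
  by apply: eq_is_derive (is_deriveD fr gr) => [t|]; rewrite ?fctE reim.
by apply: eq_is_derive (is_deriveD fi gi) => [t|]; rewrite ?fctE reim.
Qed.

Lemma cderivN f x k : cderiv f x k -> cderiv (fun t => - f t) x (- k).
Proof.
move=> [fr fi]; split.
  by apply: eq_is_derive (is_deriveN fr) => [t|]; rewrite ?fctE reim.
by apply: eq_is_derive (is_deriveN fi) => [t|]; rewrite ?fctE reim.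
Qed.

Lemma cderivJ f x k : cderiv f x k -> cderiv (fun t => (f t)^*) x (k^*).
Proof.
move=> [fr fi]; split.
  by apply: eq_is_derive fr => [t|]; rewrite ?fctE reim.
by apply: eq_is_derive (is_deriveN fi) => [t|]; rewrite ?fctE reim.
Qed.

Lemma cderivM f g x k l : cderiv f x k -> cderiv g x l ->
  cderiv (fun t => f t * g t) x (k * g x + f x * l).
Proof.
move=> [fr fi] [gr gi]; split.
  apply: eq_is_derive (is_deriveB (is_deriveM fr gr) (is_deriveM fi gi)) => [t|].
    by rewrite !fctE !reim.
  by rewrite /GRing.scale/= !reim; ring.
apply: eq_is_derive (is_deriveD (is_deriveM fr gi) (is_deriveM fi gr)) => [t|].
  by rewrite !fctE !reim.
by rewrite /GRing.scale/= !reim; ring.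
Qed.

Lemma cderiv_cst z x : cderiv (fun=> z) x 0.
Proof. by split; exact: is_derive_cst. Qed.

Lemma cderivR (h : R -> R) x (l : R) : is_derive x (1 : R) h l ->
  cderiv (fun t => (h t)%:C)%C x (l%:C)%C.
Proof. by move=> dh; split => //; exact: is_derive_cst. Qed.

Lemma L1locM f g : L1loc f -> clocAC g -> L1loc (fun x => f x * g x).
Proof.
move=> [fr fi] [/locAC_continuous gr /locAC_continuous gi]; split.
  apply: locally_integrable_ext (locally_integrableB (locally_integrableMc fr gr) (locally_integrableMc fi gi)) => x.
  by rewrite !reim.
apply: locally_integrable_ext (locally_integrableD (locally_integrableMc fr gi) (locally_integrableMc fi gr)) => x.
by rewrite !reim.
Qed.

Lemma L1locD f g : L1loc f -> L1loc g -> L1loc (fun x => f x + g x).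
Proof.
move=> [fr fi] [gr gi]; split.
  by apply: locally_integrable_ext (locally_integrableD fr gr) => x; rewrite reim.
by apply: locally_integrable_ext (locally_integrableD fi gi) => x; rewrite reim.
Qed.

Lemma L1locN f : L1loc f -> L1loc (fun x => - f x).
Proof.
move=> [fr fi]; split.
  by apply: locally_integrable_ext (locally_integrableN fr) => x; rewrite reim.
by apply: locally_integrable_ext (locally_integrableN fi) => x; rewrite reim.
Qed.

Lemma L1locJ f : L1loc f -> L1loc (fun x => (f x)^*).
Proof.
move=> [fr fi]; split.
  by apply: locally_integrable_ext fr => x; rewrite reim.
by apply: locally_integrable_ext (locally_integrableN fi) => x; rewrite reim.
Qed.

Lemma cprim_clocAC f : L1loc f -> clocAC (cprim f).
Proof. by move=> [fr fi]; split; exact: prim_locAC. Qed.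

Lemma cprim_cderiv f : L1loc f -> {ae mu, forall x, cderiv (cprim f) x (f x)}.
Proof.
by move=> [fr fi]; apply: (ae_imp2 (prim_is_derive fr) (prim_is_derive fi)).
Qed.

Lemma clocAC_cderiv0 f : clocAC f -> {ae mu, forall x, cderiv f x 0} ->
  forall x y, f y = f x.
Proof.
move=> [fr fi] f0.
suff H x y : x <= y -> f y = f x by move=> x y; have [/H|/ltW/H] := leP x y.
move=> xy; apply: complex_eqP.
  by apply: (locAC_is_derive0 fr _ xy); apply: (ae_imp f0) => t [].
by apply: (locAC_is_derive0 fi _ xy); apply: (ae_imp f0) => t [].
Qed.

(* With the further column (- beta^*, alpha^* ), the pair (alpha, beta) is an
   SU(2)-valued fundamental matrix of F' = ((0, q), (- q^*, 0)) F. *)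
Lemma fundamental_solution (q : R -> C) : L1loc q ->
  exists alpha beta : R -> C, [/\ clocAC alpha, clocAC beta,
    {ae mu, forall x, cderiv alpha x (q x * beta x) /\ cderiv beta x (- (q x)^* * alpha x)} &
    forall x, alpha x * (alpha x)^* + beta x * (beta x)^* = 1].
Proof.
move=> lq; have [lu lv] := lq.
pose u x := complex.Re (q x); pose v x := complex.Im (q x).
(* With q = u + i v, alpha = X0 + i X1 and beta = X2 + i X3, the rows are the real and imaginary
   parts of q beta and of - conj(q) alpha. *)
pose M x : seq (seq R) := [:: [:: 0; 0; u x; - v x]; [:: 0; 0; v x; u x];
  [:: - u x; - v x; 0; 0]; [:: v x; - u x; 0; 0]].
pose A (i j : 'I_4) x := nth 0 (nth [::] (M x) i) j.
have l0 : locally_integrable setT (fun=> 0 : R).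
  by apply: continuous_locally_integrable; exact: cst_continuous.
have lNu := locally_integrableN lu; have lNv := locally_integrableN lv.
have lA i j : locally_integrable setT (A i j).
  by case: i j => [[|[|[|[|i]]]] ilt] [[|[|[|[|j]]]] jlt].
(* The initial value is alpha(0) = 1, beta(0) = 0, the first column of the identity matrix. *)
pose c (i : 'I_4) : R := (i == 0 :> nat)%:R.
have [X HX] := linear_ode_solution c lA.
have i0 : (0 < 4)%N by []. have i1 : (1 < 4)%N by [].
have i2 : (2 < 4)%N by []. have i3 : (3 < 4)%N by [].
pose Y k (kl : (k < 4)%N) := X (Ordinal kl).
pose alpha x := complex.Complex (Y _ i0 x) (Y _ i1 x).
pose beta x := complex.Complex (Y _ i2 x) (Y _ i3 x).
have [AC0 X00 D0] := HX (Ordinal i0); have [AC1 X10 D1] := HX (Ordinal i1).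
have [AC2 X20 D2] := HX (Ordinal i2); have [AC3 X30 D3] := HX (Ordinal i3).
have DX : {ae mu, forall x, cderiv alpha x (q x * beta x) /\ cderiv beta x (- (q x)^* * alpha x)}.
  have sumE (i : 'I_4) x : \sum_(j < 4) A i j x * X j x =
      A i (Ordinal i0) x * Y _ i0 x + A i (Ordinal i1) x * Y _ i1 x +
      A i (Ordinal i2) x * Y _ i2 x + A i (Ordinal i3) x * Y _ i3 x.
    rewrite !big_ord_recl big_ord0 addr0 !addrA /Y.
    by do !congr (_ + _); congr (A i _ x * X _ x); apply: val_inj.
  have D01 := ae_imp2 D0 D1 (fun x p r => conj p r).
  have D23 := ae_imp2 D2 D3 (fun x p r => conj p r).
  apply: (ae_imp2 D01 D23) => x [d0 d1] [d2 d3].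
  split; split; [apply: eq_is_derive d0|apply: eq_is_derive d1|
    apply: eq_is_derive d2|apply: eq_is_derive d3] => //;
    by rewrite sumE /A /alpha /beta/= !reim/= /u /v /Y; ring.
have nsq1 x : alpha x * (alpha x)^* + beta x * (beta x)^* = 1.
  have ACa : clocAC alpha by [].
  have ACb : clocAC beta by [].
  have <- : alpha 0 * (alpha 0)^* + beta 0 * (beta 0)^* = 1.
    apply: complex_eqP; rewrite !reim /alpha /beta/= /Y X00 X10 X20 X30 /c/=; ring.
  (* The squared norm of the column has derivative zero: the four terms containing [q] cancel in
     pairs. *)
  apply: (@clocAC_cderiv0 (fun x => alpha x * (alpha x)^* + beta x * (beta x)^*)).
    by apply: clocACD; apply: clocACM => //; exact: clocACJ.
  apply: (ae_imp DX) => t [da db].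
  have := cderivD (cderivM da (cderivJ da)) (cderivM db (cderivJ db)).
  congr (cderiv _ _ _); apply: complex_eqP; rewrite !reim; ring.
by exists alpha, beta; split.
Qed.

End ComplexValued.

(** * The du Bois-Reymond lemma *)

Section DuBoisReymond.
Context {R : realType}.
Local Notation mu := (@lebesgue_measure R).
Implicit Types (f g h k : R -> R) (s t e x a b : R).

Lemma Rintegral_support f a b : (forall x, x < a \/ b < x -> f x = 0) ->
  \int[mu]_x f x = \int[mu]_(x in `[a, b]) f x.
Proof.
move=> f0; rewrite [RHS]Rintegral_mkcond; apply: eq_Rintegral => x _.
rewrite patchE; case: ifPn => //; rewrite notin_setE/= in_itv/= => /negP.
by rewrite negb_and -!ltNge => /orP; exact: f0.
Qed.

Lemma ae_neq s : {ae mu, forall x, x != s}.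
Proof.
exists [set s]; split; [exact: measurable_set1|exact: lebesgue_measure_set1|].
by move=> x /= /negP; rewrite negbK => /eqP.
Qed.

Definition ramp e s x := Num.max 0 (Num.min e (x - s)).

Lemma ramp_le s e x : x <= s -> ramp e s x = 0.
Proof.
move=> xs; rewrite /ramp; apply/max_idPl; rewrite ge_min; apply/orP; right; lra.
Qed.

Lemma ramp_ge s e x : 0 < e -> s + e <= x -> ramp e s x = e.
Proof.
move=> e0 xs; rewrite /ramp (min_idPl _); last lra.
by apply/max_idPr; exact: ltW.
Qed.

Lemma ramp_mid s e x : s <= x -> x <= s + e -> ramp e s x = x - s.
Proof.
move=> sx xs; rewrite /ramp (min_idPr _); last lra.
by apply/max_idPr; lra.
Qed.

Lemma ramp_bound s e x : 0 < e -> 0 <= ramp e s x <= e.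
Proof.
move=> e0; rewrite /ramp le_max lexx/= ge_max (ltW e0)/= ge_min lexx//.
Qed.

Lemma ramp_locAC s e : 0 < e -> locAC (ramp e s).
Proof.
move=> e0; apply: (@locAC_lipschitz _ _ 1) => u v uv; rewrite mul1r.
have [us|us] := leP u s; have [vs|vs] := leP v s.
- rewrite !ramp_le// subrr normr0; lra.
- rewrite (ramp_le e us) subr0; have [ve|ve] := leP v (s + e).
    by rewrite ramp_mid// ?ger0_norm; lra.
  by rewrite ramp_ge// ?ger0_norm; lra.
- by have := le_trans uv vs; lra.
- have [ue|ue] := leP u (s + e); have [ve|ve] := leP v (s + e).
  + by rewrite !ramp_mid// ?ger0_norm; lra.
  + by rewrite (ramp_mid (ltW us) ue) ramp_ge// ?ger0_norm; lra.
  + by have := le_trans uv ve; lra.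
  + by rewrite !ramp_ge// ?subrr ?normr0; lra.
Qed.

Lemma ramp_is_derive s e : 0 < e ->
  {ae mu, forall x, is_derive x (1 : R) (ramp e s) (\1_(`]s, s + e]%classic : set R) x)}.
Proof.
move=> e0; apply: (ae_imp2 (ae_neq s) (ae_neq (s + e))) => x xs xe.
rewrite indicE; have [ltxs|ltsx|/eqP] := ltgtP x s; last by rewrite (negPf xs).
- rewrite memNset/=; last by rewrite in_itv/= => /andP[]; lra.
  apply: (near_eq_is_derive _ (is_derive_cst (0 : R) x (1 : R))).
  exists (s - x) => [|y]; first by rewrite /= subr_gt0.
  rewrite /ball_/= => /ltr_normlP[? ?]; rewrite ramp_le//; lra.
- have [ltxe|ltex|/eqP] := ltgtP x (s + e); last by rewrite (negPf xe).
    rewrite mem_set/=; last by rewrite in_itv/= ltsx ltW.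
    have D := is_deriveB (is_derive_id x (1 : R)) (is_derive_cst s x (1 : R)).
    rewrite subr0 in D.
    apply: near_eq_is_derive D.
    exists (Num.min (x - s) (s + e - x)) => [|y].
      by rewrite /= lt_min !subr_gt0 ltsx.
    rewrite /ball_/= lt_min => /andP[/ltr_normlP[? ?] /ltr_normlP[? ?]].
    rewrite ramp_mid ?fctE//; lra.
  rewrite memNset/=; last by rewrite in_itv/= => /andP[]; lra.
  apply: (near_eq_is_derive _ (is_derive_cst e x (1 : R))).
  exists (x - (s + e)) => [|y]; first by rewrite /= subr_gt0.
  rewrite /ball_/= => /ltr_normlP[? ?]; rewrite ramp_ge//; lra.
Qed.

(** For s + e <= t a trapezoid of height [e] over [s, t + e] with slopes 1 and -1. The order of [s]
    and [t] is left free, exchanging them only changes the sign, so that two positions are compared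
    without cases. *)
Definition trap e s t x := ramp e s x - ramp e t x.
Definition dtrap e s t x : R :=
  \1_(`]s, s + e]%classic : set R) x - \1_(`]t, t + e]%classic : set R) x.

Lemma trap_locAC e s t : 0 < e -> locAC (trap e s t).
Proof. by move=> e0; apply: locACB; exact: ramp_locAC. Qed.

Lemma trap_is_derive e s t : 0 < e ->
  {ae mu, forall x, is_derive x (1 : R) (trap e s t) (dtrap e s t x)}.
Proof.
move=> e0; apply: (ae_imp2 (ramp_is_derive s e0) (ramp_is_derive t e0)) => x ds dt.
exact: is_deriveB.
Qed.

Lemma trap_support e s t x : 0 < e -> x < Num.min s t \/ Num.max s t + e < x ->
  trap e s t x = 0 /\ dtrap e s t x = 0.
Proof.
move=> e0 H; rewrite /trap /dtrap !indicE.
have [[xs xt]|[xs xt]] : (x <= s /\ x <= t) \/ (s + e < x /\ t + e < x).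
  case: H => [|]; first by rewrite lt_min => /andP[/ltW ? /ltW ?]; left.
  by rewrite -ltrBrDr gt_max => /andP[? ?]; right; split; lra.
- by rewrite !ramp_le// !memNset/= ?subrr//= in_itv/= => /andP[]; lra.
- by rewrite !ramp_ge ?(ltW xs) ?(ltW xt)// !memNset/= ?subrr//= in_itv/= => /andP[]; lra.
Qed.

Lemma Rintegral_indic_itv h a b u v : locally_integrable setT h -> a <= u -> u <= v -> v <= b ->
  \int[mu]_(x in `[a, b]) (\1_(`]u, v]%classic : set R) x * h x) = prim h v - prim h u.
Proof.
move=> lh au uv vb; rewrite prim_sub//.
have sub : `]u, v]%classic `<=` `[a, b]%classic.
  move=> x /=; rewrite !in_itv/= => /andP[ux xv].
  by rewrite (le_trans au (ltW ux)) (le_trans xv vb).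
rewrite -(@Rintegral_itv_obnd_cbnd R u (BRight v) h); last first.
  by apply: integrableS (locally_integrable_itv u v lh) => //; exact: subset_itv_oc_cc.
rewrite -[in RHS](setIidr sub) Rintegral_mkcondr; apply: eq_Rintegral => x _.
by rewrite patchE indicE; case: ifP; rewrite ?mul1r ?mul0r.
Qed.

(* Subtracting K = prim k and integrating by parts reduces the hypothesis to
   \int dtrap * (g + K) = 0: the primitive H of g + K has the same increment over
   all intervals of a given length, so its derivative does not depend on the point. *)
Lemma du_bois_reymond g k : locally_integrable setT g -> locally_integrable setT k ->
  (forall e s t, 0 < e ->
     \int[mu]_x (dtrap e s t x * g x) = \int[mu]_x (trap e s t x * k x)) ->
  exists c : R, {ae mu, forall x, g x = c - prim k x}.
Proof.
move=> lg lk H; pose h x := g x + prim k x; pose P := prim h.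
have ACK := prim_locAC lk.
have lK := continuous_locally_integrable (locAC_continuous ACK).
have lh : locally_integrable setT h by exact: locally_integrableD.
have lI u v f : locally_integrable setT f ->
    locally_integrable setT (fun x => \1_(`]u, v]%classic : set R) x * f x).
  move=> lf; have [mf _ _] := lf.
  apply: (locally_integrable_dominated 0 _ lf).
    by apply: measurable_funM => //; apply: measurable_indic; exact: measurable_itv.
  move=> K _; exists 1 => x _; rewrite normrM ler_wpM2r// indicE.
  by case: (_ \in _); rewrite /= ?normr1 ?normr0.
have ldt e s t f : locally_integrable setT f -> locally_integrable setT (fun x => dtrap e s t x * f x).
  move=> lf; have := locally_integrableB (lI s (s + e) _ lf) (lI t (t + e) _ lf).
  by apply: locally_integrable_ext => x; rewrite /dtrap mulrBl.
have Padd e s t : 0 < e -> P (s + e) - P s = P (t + e) - P t.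
  move=> e0; pose a := Num.min s t; pose b := Num.max s t + e.
  have [as_ at_] : a <= s /\ a <= t by rewrite /a !ge_min !lexx orbT.
  have [sb tb] : s + e <= b /\ t + e <= b by rewrite /b !lerD2r !le_max !lexx orbT.
  have ab : a <= b by apply: (le_trans as_); apply: le_trans sb; lra.
  have supp x : x < a \/ b < x -> trap e s t x = 0 /\ dtrap e s t x = 0.
    exact: trap_support.
  have ACtK : locAC (fun x => trap e s t x * prim k x).
    by apply: locACM => //; exact: trap_locAC.
  have ltk : locally_integrable setT (fun x => trap e s t x * k x).
    have := locally_integrableMc lk (locAC_continuous (trap_locAC s t e0)).
    by apply: locally_integrable_ext => x; rewrite mulrC.
  have I0 : \int[mu]_(x in `[a, b]) (dtrap e s t x * h x) = 0.
    have E : \int[mu]_(x in `[a, b]) (dtrap e s t x * prim k x + trap e s t x * k x) = 0.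
      (* The integrand is the derivative of [trap * prim k], and the trapezoid vanishes at [a] and
         [b]. *)
      rewrite -(prim_sub (locally_integrableD (ldt _ _ _ _ lK) ltk) ab).
      rewrite -(locAC_prim ACtK (locally_integrableD (ldt e s t _ lK) ltk)).
        rewrite /trap (ramp_le e as_) (ramp_le e at_) (ramp_ge e0 sb) (ramp_ge e0 tb).
        by rewrite !subrr !mul0r subrr.
      apply: (ae_imp2 (trap_is_derive s t e0) (prim_is_derive lk)) => x dt dk.
      have := is_deriveM dt dk; apply: eq_is_derive => //.
      by rewrite /GRing.scale/= addrC [dtrap _ _ _ _ * _]mulrC.
    have H' := H e s t e0.
    rewrite (@Rintegral_support _ a b) in H'; last by move=> x /supp[_ ->]; rewrite mul0r.
    rewrite (@Rintegral_support (fun x => trap e s t x * k x) a b) in H'; last by move=> x /supp[-> _]; rewrite mul0r.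
    rewrite RintegralD// in E; [|exact: (locally_integrable_itv _ _ (ldt _ _ _ _ lK))|exact: locally_integrable_itv].
    under eq_Rintegral do rewrite /h mulrDr.
    rewrite RintegralD//; [|exact: (locally_integrable_itv _ _ (ldt _ _ _ _ lg))|exact: (locally_integrable_itv _ _ (ldt _ _ _ _ lK))].
    by rewrite H' addrC.
  move: I0; under eq_Rintegral do rewrite mulrBl.
  rewrite RintegralB//; [|exact: (locally_integrable_itv _ _ (lI _ _ _ lh))|exact: (locally_integrable_itv _ _ (lI _ _ _ lh))].
  have [sse tte] : s <= s + e /\ t <= t + e by rewrite !lerDl ltW.
  rewrite (Rintegral_indic_itv lh as_ sse sb) (Rintegral_indic_itv lh at_ tte tb).
  by move=> /eqP; rewrite subr_eq0 => /eqP.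
(* By [Padd] the difference quotients of [P] at 0 and at any [x] are the same function of the
   increment, so [derive1 P 0] equals [h x] wherever [P] has derivative [h x]. *)
exists (derive1 P 0).
apply: (ae_imp (prim_is_derive lh)) => x dx.
suff -> : derive1 P 0 = h x by rewrite /h addrK.
rewrite -(@derive_val _ _ _ _ _ _ _ dx) -derive1E /derive1.
suff -> : (fun d => d^-1 *: (P (d + 0) - P 0)) = (fun d => d^-1 *: (P (d + x) - P x)) by [].
apply/funext => d; congr (_ *: _).
rewrite addr0; have [d0|d0|->] := ltgtP d 0.
(* For a negative increment [Padd] is applied with length [- d] at the points [x + d] and [d]. *)
- have Nd : 0 < - d by rewrite oppr_gt0.
  by have := Padd _ (x + d) d Nd; rewrite subrr addrK (addrC d x); lra.
- by have := Padd _ x 0 d0; rewrite add0r (addrC d x).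
- by rewrite !add0r !subrr.
Qed.

End DuBoisReymond.

(** * Square integrable functions *)

Section SquareIntegrable.
Context {R : realType}.
Local Notation mu := (@lebesgue_measure R).
Local Notation C := (R[i]).
Local Notation vfun := (@vfun R).
Implicit Types (f g : R -> C) (z w : C) (F G H : vfun).

Definition cmeas f := measurable_fun setT (fun x => complex.Re (f x)) /\
  measurable_fun setT (fun x => complex.Im (f x)).

Lemma eq_measurable_fun (h k : R -> R) : h =1 k -> measurable_fun setT h ->
  measurable_fun setT k.
Proof. by move=> /funext ->. Qed.

Lemma cmeasD f g : cmeas f -> cmeas g -> cmeas (fun x => f x + g x).
Proof.
move=> [fr fi] [gr gi]; split.
  by apply: eq_measurable_fun (measurable_funD fr gr) => x; rewrite reim.
by apply: eq_measurable_fun (measurable_funD fi gi) => x; rewrite reim.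
Qed.

Lemma cmeasM f g : cmeas f -> cmeas g -> cmeas (fun x => f x * g x).
Proof.
move=> [fr fi] [gr gi]; split.
  apply: eq_measurable_fun (measurable_funB (measurable_funM fr gr) (measurable_funM fi gi)) => x.
  by rewrite !reim.
apply: eq_measurable_fun (measurable_funD (measurable_funM fr gi) (measurable_funM fi gr)) => x.
by rewrite !reim.
Qed.

Lemma cmeas_cst z : cmeas (fun=> z).
Proof. by split; exact: measurable_cst. Qed.

Lemma cmeasN f : cmeas f -> cmeas (fun x => - f x).
Proof.
move=> mf; have := cmeasM (cmeas_cst (- 1)) mf.
by congr cmeas; apply/funext => x; rewrite mulN1r.
Qed.

Lemma cmeasJ f : cmeas f -> cmeas (fun x => (f x)^*).
Proof.
move=> mf; have [_ ni] := cmeasN mf; have [fr _] := mf; split.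
  by apply: eq_measurable_fun fr => x; rewrite reim.
by apply: eq_measurable_fun ni => x; rewrite !reim.
Qed.

Lemma cmeasR (h : R -> R) : measurable_fun setT h -> cmeas (fun x => (h x)%:C)%C.
Proof. by move=> mh; split => //; exact: measurable_cst. Qed.

Lemma clocAC_cmeas f : clocAC f -> cmeas f.
Proof. by move=> [/locAC_continuous fr /locAC_continuous fi]; split; exact: continuous_measurable_fun. Qed.

Lemma L2P F : L2 F <-> [/\ cmeas (fun x => (F x).1), cmeas (fun x => (F x).2) &
  (\int[mu]_x (nsq F x)%:E < +oo)%E].
Proof. by split=> [[? ? ? ? ?]|[[? ?] [? ?] ?]]; split. Qed.

Lemma sqn_ge0 z : 0 <= sqn z.
Proof. by rewrite addr_ge0 ?sqr_ge0. Qed.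

Lemma nsq_ge0 F x : 0 <= nsq F x.
Proof. by rewrite addr_ge0 ?sqn_ge0. Qed.

Lemma sqnM z w : sqn (z * w) = sqn z * sqn w.
Proof. by rewrite /sqn !reim; ring. Qed.

Lemma sqnN z : sqn (- z) = sqn z.
Proof. by rewrite /sqn !reim !sqrrN. Qed.

Lemma sqnJ z : sqn z^* = sqn z.
Proof. by rewrite /sqn !reim sqrrN. Qed.

Lemma sqni : sqn ('i : C) = 1.
Proof. by rewrite /sqn !reim expr0n expr1n add0r. Qed.

Lemma sqnR (x : R) : sqn (x%:C)%C = x ^+ 2.
Proof. by rewrite /sqn !reim expr0n addr0. Qed.

Lemma sqnD z w : sqn (z + w) <= 2 * sqn z + 2 * sqn w.
Proof.
rewrite /sqn !reim.
have := sqr_ge0 (complex.Re z - complex.Re w).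
have := sqr_ge0 (complex.Im z - complex.Im w).
by move: (complex.Re z) (complex.Re w) (complex.Im z) (complex.Im w) => a b c d; nra.
Qed.

Lemma measurable_nsq F : cmeas (fun x => (F x).1) -> cmeas (fun x => (F x).2) ->
  measurable_fun setT (nsq F).
Proof.
move=> [? ?] [? ?]; apply: measurable_funD; apply: measurable_funD;
  exact: measurable_funX.
Qed.

Lemma L2_nsq_integrable F : L2 F -> mu.-integrable setT (EFin \o nsq F).
Proof.
move=> /L2P[m1 m2 foo]; apply/integrableP; split.
  by apply/measurable_EFinP; exact: measurable_nsq.
by under eq_integral do rewrite /= ger0_norm ?nsq_ge0//.
Qed.

Lemma L2_dominated F (g : R -> R) : cmeas (fun x => (F x).1) -> cmeas (fun x => (F x).2) ->
  mu.-integrable setT (EFin \o g) -> (forall x, nsq F x <= g x) -> L2 F.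
Proof.
move=> m1 m2 ig Fg; apply/L2P; split => //.
have : mu.-integrable setT (EFin \o nsq F).
  apply: le_integrable ig => //.
    by apply/measurable_EFinP; exact: measurable_nsq.
  move=> x _; rewrite lee_fin ger0_norm ?nsq_ge0// (le_trans (Fg x))//.
  exact: ler_norm.
move=> /integrableP[_]; congr (_ < _)%E; apply: eq_integral => x _ /=.
by rewrite ger0_norm// nsq_ge0.
Qed.

Lemma L2_aeq F G : cmeas (fun x => (G x).1) -> cmeas (fun x => (G x).2) ->
  L2 F -> aeq F G -> L2 G.
Proof.
move=> m1 m2 /L2P[f1 f2 foo] FG; apply/L2P; split => //.
rewrite (@ae_eq_integral _ _ _ mu setT (EFin \o nsq F))//.
- by apply/measurable_EFinP; exact: measurable_nsq.
- by apply/measurable_EFinP; exact: measurable_nsq.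
- by apply: (ae_imp FG) => x e _; rewrite /= /nsq e.
Qed.

Lemma L2_locally_integrable F (h : R -> R) : L2 F -> measurable_fun setT h ->
  (forall x, `|h x| <= 1 + nsq F x) -> locally_integrable setT h.
Proof.
move=> LF mh hF.
have l1 : locally_integrable setT (fun=> 1 : R).
  by apply: continuous_locally_integrable; exact: cst_continuous.
have lF := open_integrable_locally openT (L2_nsq_integrable LF).
apply: (locally_integrable_dominated 0 mh (locally_integrableD l1 lF)) => K _.
exists 1 => x _; rewrite mul1r (le_trans (hF x))// ler_norm.
by [].
Qed.

(** The inequality |a| <= 1 + a^2 and the local integrability of constants do the work of
    Cauchy-Schwarz. *)
Lemma L2_L1loc F : L2 F -> L1loc (fun x => (F x).1) /\ L1loc (fun x => (F x).2).
Proof.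
move=> LF; have [m1 m2 m3 m4 _] := LF.
have E (a b c d : R) : `|a| <= 1 + (a ^+ 2 + b ^+ 2 + (c ^+ 2 + d ^+ 2)).
  have := sqr_ge0 (a - 1); have := sqr_ge0 (a + 1).
  have := sqr_ge0 b; have := sqr_ge0 c; have := sqr_ge0 d.
  by move=> *; rewrite ler_norml; apply/andP; split; nra.
split; split; apply: (L2_locally_integrable LF) => // x; rewrite /nsq /sqn.
- exact: E.
- by have := E (complex.Im (F x).1) (complex.Re (F x).1) (complex.Re (F x).2) (complex.Im (F x).2); lra.
- by have := E (complex.Re (F x).2) (complex.Im (F x).2) (complex.Re (F x).1) (complex.Im (F x).1); lra.
- by have := E (complex.Im (F x).2) (complex.Re (F x).2) (complex.Re (F x).1) (complex.Im (F x).1); lra.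
Qed.

Definition ipd F G x : C := (F x).1 * (G x).1^* + (F x).2 * (G x).2^*.

(** Young's inequality with a free weight. Choosing [t] afterwards replaces the Cauchy-Schwarz
    inequality when a limit is taken in one factor. *)
Lemma ler_norm_mul_weighted (t x y : R) : 0 < t -> `|x * y| <= t * x ^+ 2 + t^-1 * y ^+ 2.
Proof.
move=> t0; rewrite (_ : y = t * (t^-1 * y)); last by rewrite mulrA divff ?mul1r// gt_eqF.
move: (t^-1 * y) => z; rewrite (_ : _ + _ = t * (x ^+ 2 + z ^+ 2)); last first.
  by field; rewrite gt_eqF.
rewrite mulrCA normrM (gtr0_norm t0) ler_pM2l//.
by rewrite ler_norml; apply/andP; split; nra.
Qed.

Lemma ipd_bound (t : R) F G x : 0 < t ->
  `|complex.Re (ipd F G x)| <= t * nsq F x + t^-1 * nsq G x /\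
  `|complex.Im (ipd F G x)| <= t * nsq F x + t^-1 * nsq G x.
Proof.
move=> t0; rewrite /ipd /nsq /sqn !reim.
move: (complex.Re (F x).1) (complex.Im (F x).1) (complex.Re (F x).2) (complex.Im (F x).2) => a b c d.
move: (complex.Re (G x).1) (complex.Im (G x).1) (complex.Re (G x).2) (complex.Im (G x).2) => a' b' c' d'.
have B (x1 x2 x3 x4 y1 y2 y3 y4 : R) : `|x1 * y1 + x2 * y2 + x3 * y3 + x4 * y4| <=
    t * (x1 ^+ 2 + x2 ^+ 2 + x3 ^+ 2 + x4 ^+ 2) +
    t^-1 * (y1 ^+ 2 + y2 ^+ 2 + y3 ^+ 2 + y4 ^+ 2).
  have := ler_norm_mul_weighted x1 y1 t0; have := ler_norm_mul_weighted x2 y2 t0.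
  have := ler_norm_mul_weighted x3 y3 t0; have := ler_norm_mul_weighted x4 y4 t0.
  have := ler_normD (x1 * y1 + x2 * y2 + x3 * y3) (x4 * y4).
  have := ler_normD (x1 * y1 + x2 * y2) (x3 * y3).
  have := ler_normD (x1 * y1) (x2 * y2).
  by lra.
split.
  have := B a b c d a' b' c' d'; congr (`|_| <= _); ring.
have := B a b c d (- b') a' (- d') c'; congr (`|_| <= _); ring.
Qed.

Lemma ipd_integrable F G : L2 F -> L2 G ->
  mu.-integrable setT (EFin \o (fun x => complex.Re (ipd F G x))) /\
  mu.-integrable setT (EFin \o (fun x => complex.Im (ipd F G x))).
Proof.
move=> LF LG; have /L2P[f1 f2 _] := LF; have /L2P[g1 g2 _] := LG.
have [mr mi] : cmeas (ipd F G).
  by apply: cmeasD; apply: cmeasM => //; exact: cmeasJ.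
have iFG : mu.-integrable setT (EFin \o (fun x => nsq F x + nsq G x)).
  exact: (integrableD measurableT (L2_nsq_integrable LF) (L2_nsq_integrable LG)).
have B x := @ipd_bound 1 F G x ltr01.
split; apply: le_integrable iFG => //; try by apply/measurable_EFinP.
  move=> x _; have [+ _] := B x; rewrite invr1 !mul1r lee_fin => /le_trans; apply.
  exact: ler_norm.
move=> x _; have [_ +] := B x; rewrite invr1 !mul1r lee_fin => /le_trans; apply.
exact: ler_norm.
Qed.

Definition vsub F G : vfun := fun y => ((F y).1 - (G y).1, (F y).2 - (G y).2).

Lemma L2_sub F G : L2 F -> L2 G -> L2 (vsub F G).
Proof.
move=> LF LG; have /L2P[f1 f2 _] := LF; have /L2P[g1 g2 _] := LG.
have iFG : mu.-integrable setT (EFin \o (fun x => 2 * nsq F x + 2 * nsq G x)).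
  exact: (integrableD measurableT (integrableZl measurableT 2 (L2_nsq_integrable LF))
    (integrableZl measurableT 2 (L2_nsq_integrable LG))).
apply: L2_dominated iFG _.
- by apply: cmeasD => //; exact: cmeasN.
- by apply: cmeasD => //; exact: cmeasN.
- move=> x; rewrite /nsq /=.
  have := sqnD (F x).1 (- (G x).1); have := sqnD (F x).2 (- (G x).2).
  by rewrite !sqnN; lra.
Qed.

Lemma ip_sub F G H : L2 F -> L2 G -> L2 H -> ip (vsub F G) H = ip F H - ip G H.
Proof.
move=> LF LG LH; have [fr fi] := ipd_integrable LF LH.
have [gr gi] := ipd_integrable LG LH.
apply: complex_eqP; rewrite !reim /= -RintegralB//; apply: eq_Rintegral => x _;
  rewrite /vsub/= !reim; ring.
Qed.

Lemma ipC F G : L2 F -> L2 G -> ip G F = (ip F G)^*.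
Proof.
move=> LF LG; have [fr fi] := ipd_integrable LF LG.
apply: complex_eqP; rewrite !reim/=.
  by apply: eq_Rintegral => x _; rewrite !reim; ring.
rewrite -mulN1r -RintegralZl//.
by apply: eq_Rintegral => x _; rewrite !reim; ring.
Qed.

Lemma ip_bound (t : R) F G : 0 < t -> L2 F -> L2 G ->
  let N := t * (\int[mu]_x nsq F x) + t^-1 * (\int[mu]_x nsq G x) in
  `|complex.Re (ip F G)| <= N /\ `|complex.Im (ip F G)| <= N.
Proof.
move=> t0 LF LG /=; have [fr fi] := ipd_integrable LF LG.
have iF := L2_nsq_integrable LF; have iG := L2_nsq_integrable LG.
have iF' := integrableZl measurableT t iF; have iG' := integrableZl measurableT t^-1 iG.
rewrite -RintegralZl// -RintegralZl// -RintegralD//.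
split; apply: (le_trans (le_normr_Rintegral _ _)) => //; apply: le_Rintegral => //.
- exact: integrable_norm.
- exact: (integrableD _ iF' iG').
- by move=> x _; have [] := ipd_bound F G x t0.
- exact: integrable_norm.
- exact: (integrableD _ iF' iG').
- by move=> x _; have [] := ipd_bound F G x t0.
Qed.

Lemma ip_cvg (Fs : nat -> vfun) F G : (forall n, L2 (Fs n)) -> L2 F -> L2 G ->
  (fun n => dist2 (Fs n) F) @ \oo --> 0%E ->
  (fun n => complex.Re (ip (Fs n) G)) @ \oo --> complex.Re (ip F G) /\
  (fun n => complex.Im (ip (Fs n) G)) @ \oo --> complex.Im (ip F G).
Proof.
move=> LFs LF LG /fine_cvg; set D := fine \o _ => /cvgrPdist_lt D0.
have DE n : D n = \int[mu]_x nsq (vsub (Fs n) F) x by [].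
have key e : 0 < e -> \forall n \near \oo,
    `|complex.Re (ip (Fs n) G) - complex.Re (ip F G)| <= e /\
    `|complex.Im (ip (Fs n) G) - complex.Im (ip F G)| <= e.
  move=> e0; pose N := \int[mu]_x nsq G x.
  have N0 : 0 <= N by apply: Rintegral_ge0 => x _; exact: nsq_ge0.
  (* With this weight the fixed factor [G] contributes at most e / 2, and the term with [D n] is
     then small for large [n]; [N + 1] instead of [N] keeps the weight positive when [G] vanishes
     almost everywhere. *)
  pose t := 2 * (N + 1) / e.
  have t0 : 0 < t by rewrite divr_gt0// mulr_gt0// ltr_wpDl.
  have tN : t^-1 * N <= e / 2.
    have N1 : 0 < N + 1 by rewrite ltr_wpDl.
    rewrite /t invf_div (_ : _ * N = e / 2 * (N / (N + 1))); last first.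
      by field; rewrite gt_eqF.
    rewrite ler_piMr ?ler_pdivrMr//; lra.
  have et0 : 0 < e / 2 / t by apply: divr_gt0 => //; exact: divr_gt0.
  near=> n.
  have Dn : t * D n <= e / 2.
    rewrite mulrC -ler_pdivlMr//; apply: ltW.
    have : `|0 - D n| < e / 2 / t by near: n; exact: D0.
    by rewrite sub0r normrN => /(le_lt_trans (ler_norm _)).
  have [b1 b2] : `|complex.Re (ip (vsub (Fs n) F) G)| <= t * D n + t^-1 * N /\
      `|complex.Im (ip (vsub (Fs n) F) G)| <= t * D n + t^-1 * N.
    exact: (ip_bound t0 (L2_sub (LFs n) LF) LG).
  rewrite (ip_sub (LFs n) LF LG) cReD cReN in b1.
  rewrite (ip_sub (LFs n) LF LG) cImD cImN in b2.
  split; first by apply: (le_trans b1); lra.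
  by apply: (le_trans b2); lra.
split; apply/cvgrPdist_le => e e0; move: (key _ e0); apply: filterS => n [k1 k2];
  by rewrite distrC.
Unshelve. all: by end_near. Qed.

(** Dominated convergence for sequences that are eventually constant at each point, as products with
    cut-off functions are. *)
Lemma dist2_cvg0 (Hs : nat -> vfun) H (g : R -> R) :
  (forall n, cmeas (fun x => (Hs n x).1)) -> (forall n, cmeas (fun x => (Hs n x).2)) ->
  cmeas (fun x => (H x).1) -> cmeas (fun x => (H x).2) ->
  mu.-integrable setT (EFin \o g) ->
  (forall n x, nsq (vsub (Hs n) H) x <= g x) ->
  (forall x, \forall n \near \oo, Hs n x = H x) ->
  (fun n => dist2 (Hs n) H) @ \oo --> 0%E.
Proof.
move=> m1 m2 h1 h2 ig Hg HsH.
rewrite (_ : 0%E = (\int[mu]_(x in setT) (cst 0%E x))%E); last by rewrite integral0.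
apply: (@dominated_cvg _ _ _ mu setT measurableT (fun n => EFin \o nsq (vsub (Hs n) H)) (cst 0%E) (EFin \o g)) => //.
- move=> n; apply/measurable_EFinP; apply: measurable_nsq.
    by apply: cmeasD => //; exact: cmeasN.
  by apply: cmeasD => //; exact: cmeasN.
- move=> x _; apply: cvg_near_cst; move: (HsH x); apply: filterS => n /= E.
  by rewrite /nsq /vsub/= E !subrr /sqn !reim expr0n/= !addr0.
- by move=> n x _; rewrite lee_fin ger0_norm ?nsq_ge0.
Qed.

End SquareIntegrable.

(** * The Dirac operator *)

(** Conjugation is pushed down to the atoms, whose conjugates then count as independent variables;
    the only further relation is that the square of i is -1. *)
Ltac complex_ring R := rewrite ?conjcE; ring: (@mulcii R).

Section DiracOperator.
Context {R : realType}.
Local Notation mu := (@lebesgue_measure R).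
Local Notation C := (R[i]).
Local Notation vfun := (@vfun R).
Implicit Types (q : R -> C) (F G : vfun).

(** The two rows of G = M(q)F solved for the derivatives, the form in which the product rule
    applies. *)
Lemma DmaxP q F G : Dmax q F G <->
  [/\ L2 F, clocAC (fun x => (F x).1), clocAC (fun x => (F x).2), L2 G &
    {ae mu, forall x, cderiv (fun t => (F t).1) x (q x * (F x).2 - 'i * (G x).1) /\
                      cderiv (fun t => (F t).2) x (- (q x)^* * (F x).1 + 'i * (G x).2)}].
Proof.
split=> [[LF [? ? ? ?] LG H]|[LF [? ?] [? ?] LG H]]; split => //.
  apply: (ae_imp H) => x [d1 d2 ->]; rewrite /Mq/=.
  split; apply/cderiveP; split => //; move: (cderive _ x) (q x) (F x).1 (F x).2 => d z u v;
    by complex_ring R.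
apply: (ae_imp H) => x [/cderiveP[d1 e1] /cderiveP[d2 e2]]; split => //.
rewrite /Mq e1 e2 [LHS]surjective_pairing; congr (_, _);
  move: (q x) (F x).1 (F x).2 (G x).1 (G x).2 => z u v u' v'; by complex_ring R.
Qed.

Lemma Rintegral_derive_compact_support (f g : R -> R) a b : locAC f ->
  (forall x, x < a \/ b < x -> f x = 0) -> mu.-integrable setT (EFin \o g) ->
  {ae mu, forall x, is_derive x (1 : R) f (g x)} -> \int[mu]_x g x = 0.
Proof.
move=> ACf f0 ig fg.
have lg := open_integrable_locally openT ig.
(* The margin 1 makes [f] vanish at both end points and near every point outside [c, d], where its
   derivative is therefore zero; min and max cover the case b < a. *)
pose c := Num.min a b - 1; pose d := Num.max a b + 1.
have ca : c < a /\ c < b by have := ge_min a a b; have := ge_min b a b; rewrite !lexx orbT /c => ? ?; split; lra.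
have bd : a < d /\ b < d by have := le_max a a b; have := le_max b a b; rewrite !lexx orbT /d => ? ?; split; lra.
have cd : c <= d by lra.
have <- : \int[mu]_(x in `[c, d]) g x = 0.
  rewrite -(prim_sub lg cd) -(locAC_prim ACf lg fg) !f0 ?subrr//; [left|right]; lra.
rewrite [RHS]Rintegral_mkcond; congr fine.
have [mg _ _] := lg.
apply: ae_eq_integral => //.
- by apply/measurable_EFinP.
- apply/measurable_EFinP; apply/(measurable_restrictT _ _).1 => //.
  exact: measurable_funTS.
- apply: (ae_imp fg) => x fx _ /=; congr (_%:E).
  rewrite patchE; case: ifPn => //; rewrite notin_setE/= in_itv/= => /negP.
  rewrite negb_and -!ltNge => cxd.
  rewrite -(@derive_val _ _ _ _ _ _ _ fx).
  have fx0 : \forall y \near x, cst (0 : R) y = f y.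
    case/orP: cxd => [xc|dx].
      exists (c - x) => [|y]; first by rewrite /= subr_gt0.
      rewrite /ball_/= => /ltr_normlP[? ?]; rewrite f0//; left; lra.
    exists (x - d) => [|y]; first by rewrite /= subr_gt0.
    rewrite /ball_/= => /ltr_normlP[? ?]; rewrite f0//; right; lra.
  by rewrite -(near_eq_derive _ fx0) derive_cst.
Qed.

(** Lagrange's identity: the derivative of F1 conj(F1') - F2 conj(F2') is -i times the difference of
    the two integrands. The terms containing [q] cancel because the second function belongs to the
    potential -q, and the compact support of the first removes the boundary terms. *)
Lemma Dmin_adj q F G F' G' : Dmin q F G -> Dmax (fun x => - q x) F' G' -> ip G F' = ip F G'.
Proof.
move=> [/DmaxP[LF ac1 ac2 LG dF] [a [b F0]]] /DmaxP[LF' ac1' ac2' LG' dF'].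
pose W x := (F x).1 * (F' x).1^* - (F x).2 * (F' x).2^*.
have [acr aci] : clocAC W.
  apply: clocACD; last apply: clocACN; apply: clocACM => //; exact: clocACJ.
have dW : {ae mu, forall x, cderiv W x (- 'i * (ipd G F' x - ipd F G' x))}.
  apply: (ae_imp2 dF dF') => x [d1 d2] [d1' d2'].
  have := cderivD (cderivM d1 (cderivJ d1')) (cderivN (cderivM d2 (cderivJ d2'))).
  congr (cderiv _ _ _); rewrite /ipd.
  move: (q x) (F x).1 (F x).2 (G x).1 (G x).2 (F' x).1 (F' x).2 (G' x).1 (G' x).2.
  by move=> z f1 f2 h1 h2 f1' f2' h1' h2'; complex_ring R.
have W0 x : x < a \/ b < x -> W x = 0.
  by move=> /F0; rewrite /W => ->; rewrite !mul0r subrr.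
have [r1 i1] := ipd_integrable LG LF'; have [r2 i2] := ipd_integrable LF LG'.
(* The factor -i exchanges the parts: the real part of the difference is the derivative of - Im W,
   the imaginary part that of Re W. *)
have Ir : \int[mu]_x (complex.Re (ipd G F' x) - complex.Re (ipd F G' x)) = 0.
  apply: (@Rintegral_derive_compact_support (fun x => - complex.Im (W x)) _ a b).
  - exact: locACN.
  - by move=> x /W0 ->; rewrite reim oppr0.
  - exact: (integrableB measurableT r1 r2).
  - apply: (ae_imp dW) => x [_ d]; have := is_deriveN d.
    apply: eq_is_derive => //; move: (ipd _ _ _) (ipd _ _ _) => u v.
    by rewrite !reim; ring.
have Ii : \int[mu]_x (complex.Im (ipd G F' x) - complex.Im (ipd F G' x)) = 0.
  apply: (@Rintegral_derive_compact_support (fun x => complex.Re (W x)) _ a b) => //.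
  - by move=> x /W0 ->; rewrite reim.
  - exact: (integrableB measurableT i1 i2).
  - apply: (ae_imp dW) => x [d _]; apply: eq_is_derive d => //.
    by move: (ipd _ _ _) (ipd _ _ _) => u v; rewrite !reim; ring.
rewrite RintegralB// in Ir; rewrite RintegralB// in Ii.
by apply: complex_eqP; apply/eqP; rewrite -subr_eq0; apply/eqP; [exact: Ir|exact: Ii].
Qed.

Lemma L2_bounded_support F (M a b : R) :
  cmeas (fun x => (F x).1) -> cmeas (fun x => (F x).2) ->
  (forall x, nsq F x <= M) -> (forall x, x < a \/ b < x -> nsq F x = 0) -> L2 F.
Proof.
move=> m1 m2 FM F0.
have i1 : mu.-integrable setT (EFin \o (fun x => M * (\1_(`[a, b]%classic : set R) x))).
  exact: (integrableZl measurableT M (integrable_indic_itv a b true false)).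
apply: (L2_dominated m1 m2 i1) => x; rewrite indicE.
case: (boolP (x \in _)) => [_|]; first by rewrite mulr1.
rewrite notin_setE/= in_itv/= => /negP.
by rewrite negb_and -!ltNge mulr0 => /orP/F0 ->.
Qed.

Definition unitary_solution q (a b : R -> C) := [/\ clocAC a, clocAC b,
  {ae mu, forall x, cderiv a x (q x * b x) /\ cderiv b x (- (q x)^* * a x)} &
  forall x, a x * (a x)^* + b x * (b x)^* = 1].

(** The system is invariant under (a, b) -> (- conj b, conj a), which sends the first column of the
    unitary matrix to the second; results about one column thus hold for both. *)
Lemma unitary_solution_dual q a b : unitary_solution q a b ->
  unitary_solution q (fun x => - (b x)^*) (fun x => (a x)^*).
Proof.
move=> [ACa ACb dab ab1]; split.
- by apply: clocACN; exact: clocACJ.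
- exact: clocACJ.
- apply: (ae_imp dab) => x [da db]; split.
    have := cderivN (cderivJ db); congr (cderiv _ _ _).
    by move: (q x) (a x) => z u; complex_ring R.
  have := cderivJ da; congr (cderiv _ _ _).
  by move: (q x) (b x) => z u; complex_ring R.
- by move=> x; rewrite -(ab1 x); move: (a x) (b x) => u v; complex_ring R.
Qed.

Lemma unitary_sqn q a b x : unitary_solution q a b -> sqn (a x) + sqn (b x) = 1.
Proof.
move=> [_ _ _ /(_ x)]; move: (a x) (b x) => u v /(congr1 (@complex.Re R)).
by rewrite /sqn !reim => <-; ring.
Qed.

(** Because the column (a, b) is annihilated by M(q), only the derivative of the trapezoid survives,
    and M(q) of the product is square integrable even where [q] is not locally square integrable. *)
Lemma test_function_Dmin q a b (e s t : R) : 0 < e -> unitary_solution q a b ->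
  Dmin q (fun x => ((trap e s t x)%:C%C * a x, (trap e s t x)%:C%C * b x))
    (fun x => ('i * (dtrap e s t x)%:C%C * a x, - 'i * (dtrap e s t x)%:C%C * b x)).
Proof.
move=> e0 ab; have [ACa ACb dab _] := ab.
have ACt : clocAC (fun x => (trap e s t x)%:C%C) by apply: clocACR; exact: trap_locAC.
have mdt : cmeas (fun x => (dtrap e s t x)%:C%C).
  apply: cmeasR; apply: measurable_funB; apply: measurable_indic; exact: measurable_itv.
have supp x : x < Num.min s t \/ Num.max s t + e < x -> trap e s t x = 0 /\ dtrap e s t x = 0.
  exact: trap_support.
have ACta := clocACM ACt ACa; have ACtb := clocACM ACt ACb.
split; last first.
  by exists (Num.min s t), (Num.max s t + e) => x /supp[-> _]; rewrite !mul0r.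
apply/DmaxP; split => //=.
(* The bounds [e ^+ 2] here and 1 below come from |a|^2 + |b|^2 = 1: the trapezoid and its
   derivative have absolute value at most [e] and 1. *)
- apply: (@L2_bounded_support _ (e ^+ 2) (Num.min s t) (Num.max s t + e)).
  + exact: clocAC_cmeas.
  + exact: clocAC_cmeas.
  + move=> x; rewrite /nsq/= !sqnM -mulrDr (unitary_sqn x ab) mulr1 sqnR.
    have := ramp_bound s x e0; have := ramp_bound t x e0; rewrite /trap.
    by move=> /andP[? ?] /andP[? ?]; nra.
  + move=> x /supp[tx _]; rewrite /nsq/= !sqnM tx sqnR expr0n/= !mul0r; ring.
- apply: (@L2_bounded_support _ 1 (Num.min s t) (Num.max s t + e)).
  + by apply: cmeasM; [apply: cmeasM => //; exact: cmeas_cst|exact: clocAC_cmeas].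
  + by apply: cmeasM; [apply: cmeasM => //; exact: cmeas_cst|exact: clocAC_cmeas].
  + move=> x; rewrite /nsq/= !sqnM sqnN sqni !mul1r -mulrDr (unitary_sqn x ab) mulr1 sqnR.
    rewrite /dtrap !indicE; case: (_ \in _); case: (_ \in _) => /=; nra.
  + move=> x /supp[_ tx]; rewrite /nsq/= !sqnM tx sqnR expr0n/= !(mul0r, mulr0); ring.
- apply: (ae_imp2 dab (trap_is_derive s t e0)) => x [da db] /cderivR dt; split.
    have := cderivM dt da; congr (cderiv _ _ _).
    by move: (q x) (a x) (b x) (trap e s t x) (dtrap e s t x) => z u v r r'; complex_ring R.
  have := cderivM dt db; congr (cderiv _ _ _).
  by move: (q x) (a x) (b x) (trap e s t x) (dtrap e s t x) => z u v r r'; complex_ring R.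
Qed.

(* Testing against a column of the gauge matrix leaves a plain derivative. *)
Lemma adj_Dmin_column q a b F G : unitary_solution q a b -> adj (Dmin q) F G ->
  let k x := a x * (G x).1^* + b x * (G x).2^* in
  L1loc k /\ exists c : C, {ae mu, forall x,
    'i * (a x * (F x).1^* - b x * (F x).2^*) = c - cprim k x}.
Proof.
move=> ab [LF LG adjF] k; have [ACa ACb _ _] := ab.
pose g x := 'i * (a x * (F x).1^* - b x * (F x).2^*).
have [lF1 lF2] := L2_L1loc LF; have [lG1 lG2] := L2_L1loc LG.
have lk : L1loc k.
  have := L1locD (L1locM (L1locJ lG1) ACa) (L1locM (L1locJ lG2) ACb).
  by congr L1loc; apply/funext => x; rewrite /k mulrC [_ * b x]mulrC.
have lg : L1loc g.
  have := L1locD (L1locM (L1locJ lF1) (clocACM (clocAC_cst 'i) ACa))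
    (L1locM (L1locJ lF2) (clocACM (clocAC_cst (- 'i)) ACb)).
  congr L1loc; apply/funext => x; rewrite /g.
  by move: (a x) (b x) (F x).1 (F x).2 => u v f1 f2; complex_ring R.
split => //.
have [lkr lki] := lk; have [lgr lgi] := lg.
(* For the test pair the adjoint relation says that the integrals of [dtrap * g] and [trap * k]
   agree; both weights are real, so it splits into real and imaginary parts. *)
have H e s t : 0 < e -> _ := fun e0 => adjF _ _ (@test_function_Dmin q a b e s t e0 ab).
have [cr Hr] : exists c : R, {ae mu, forall x, complex.Re (g x) = c - prim (fun y => complex.Re (k y)) x}.
  apply: du_bois_reymond => // e s t e0.
  have := congr1 (@complex.Re R) (H e s t e0) => /= E.
  etransitivity; last first.
    etransitivity; first exact: E.
    by apply: eq_Rintegral => x _; rewrite /k/=; move: (a x) (b x) (G x).1 (G x).2 (trap e s t x) => u v f1 f2 r; rewrite !reim; ring.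
  by apply: eq_Rintegral => x _; rewrite /g/=; move: (a x) (b x) (F x).1 (F x).2 (dtrap e s t x) => u v f1 f2 r; rewrite !reim; ring.
have [ci Hi] : exists c : R, {ae mu, forall x, complex.Im (g x) = c - prim (fun y => complex.Im (k y)) x}.
  apply: du_bois_reymond => // e s t e0.
  have := congr1 (@complex.Im R) (H e s t e0) => /= E.
  etransitivity; last first.
    etransitivity; first exact: E.
    by apply: eq_Rintegral => x _; rewrite /k/=; move: (a x) (b x) (G x).1 (G x).2 (trap e s t x) => u v f1 f2 r; rewrite !reim; ring.
  by apply: eq_Rintegral => x _; rewrite /g/=; move: (a x) (b x) (F x).1 (F x).2 (dtrap e s t x) => u v f1 f2 r; rewrite !reim; ring.
exists (complex.Complex cr ci); apply: (ae_imp2 Hr Hi) => x hr hi.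
by apply: complex_eqP; rewrite [in RHS]cReD || rewrite [in RHS]cImD; rewrite !(cReN, cImN) /=.
Qed.

(** An element of the adjoint is known only up to null sets; [U] is its locally absolutely
    continuous representative, obtained by inverting the unitary matrix in the two column
    relations. *)
Lemma adj_Dmin_regular q F G : L1loc q -> adj (Dmin q) F G ->
  exists2 U, aeq F U & Dmax (fun x => - q x) U G.
Proof.
move=> lq adjF; have [LF LG _] := adjF.
have [a [b ab]] := fundamental_solution lq.
have [ACa ACb dab ab1] := ab.
have [lk1 [c1 H1]] := adj_Dmin_column ab adjF.
have [lk2 [c2 H2]] := adj_Dmin_column (unitary_solution_dual ab) adjF.
set k1 := fun x => _ in lk1 H1; set k2 := fun x => _ in lk2 H2.
pose g1 x := c1 - cprim k1 x; pose g2 x := c2 - cprim k2 x.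
have ACg1 : clocAC g1 by apply: clocACD; [exact: clocAC_cst|apply: clocACN; exact: cprim_clocAC].
have ACg2 : clocAC g2 by apply: clocACD; [exact: clocAC_cst|apply: clocACN; exact: cprim_clocAC].
have dg1 : {ae mu, forall x, cderiv g1 x (- k1 x)}.
  apply: (ae_imp (cprim_cderiv lk1)) => x d.
  by have := cderivD (cderiv_cst c1 x) (cderivN d); rewrite add0r.
have dg2 : {ae mu, forall x, cderiv g2 x (- k2 x)}.
  apply: (ae_imp (cprim_cderiv lk2)) => x d.
  by have := cderivD (cderiv_cst c2 x) (cderivN d); rewrite add0r.
(* With Y the matrix of columns (a, b) and (- conj b, conj a) and g = (g1, g2), this is U = i
   sigma_3 Y conj(g). The factor sigma_3 accounts for the potential -q, as it anticommutes with the
   off-diagonal coefficient matrix. *)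
pose U1 x := 'i * (a x * (g1 x)^* - (b x)^* * (g2 x)^*).
pose U2 x := - 'i * (b x * (g1 x)^* + (a x)^* * (g2 x)^*).
have AC1 : clocAC U1.
  apply: clocACM; first exact: clocAC_cst.
  apply: clocACD; last apply: clocACN; apply: clocACM => //; exact: clocACJ.
have AC2 : clocAC U2.
  apply: clocACM; first exact: clocAC_cst.
  apply: clocACD; apply: clocACM => //; exact: clocACJ.
have FU : aeq F (fun x => (U1 x, U2 x)).
  apply: (ae_imp2 H1 H2) => x h1 h2.
  (* Writing 1 as |a|^2 + |b|^2 makes the inversion a polynomial identity. *)
  rewrite [LHS]surjective_pairing -[(F x).1]mul1r -[(F x).2]mul1r -(ab1 x).
  rewrite /U1 /U2 /g1 /g2 -h1 -h2; congr (_, _);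
    by move: (a x) (b x) (F x).1 (F x).2 => u v f1 f2; complex_ring R.
exists (fun x => (U1 x, U2 x)); first exact: FU.
apply/DmaxP; split; [|exact: AC1|exact: AC2|exact: LG|].
  by apply: L2_aeq FU; [exact: clocAC_cmeas|exact: clocAC_cmeas|exact: LF].
have dg : {ae mu, forall x, cderiv g1 x (- k1 x) /\ cderiv g2 x (- k2 x)}.
  exact: (ae_imp2 dg1 dg2).
apply: (ae_imp2 dab dg) => x [da db] [d1 d2] /=.
rewrite -[(G x).1]mul1r -[(G x).2]mul1r -(ab1 x); split.
  have := cderivM (cderiv_cst 'i x) (cderivD (cderivM da (cderivJ d1)) (cderivN (cderivM (cderivJ db) (cderivJ d2)))).
  congr (cderiv _ _ _); rewrite /U2 /k1 /k2.
  move: (q x) (a x) (b x) (g1 x) (g2 x) (G x).1 (G x).2 => z u v w1 w2 f1 f2.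
  by complex_ring R.
have := cderivM (cderiv_cst (- 'i) x) (cderivD (cderivM db (cderivJ d1)) (cderivM (cderivJ da) (cderivJ d2))).
congr (cderiv _ _ _); rewrite /U1 /k1 /k2.
move: (q x) (a x) (b x) (g1 x) (g2 x) (G x).1 (G x).2 => z u v w1 w2 f1 f2.
by complex_ring R.
Qed.

End DiracOperator.

(** * Cut-off functions, closures and adjoints *)

Section Closure.
Context {R : realType}.
Local Notation mu := (@lebesgue_measure R).
Local Notation C := (R[i]).
Local Notation vfun := (@vfun R).
Implicit Types (q : R -> C) (F G H K : vfun).

(** Equal to 1 on [-(n+1), n+1], zero outside [-2(n+1), 2(n+1)] and linear in between. *)
Definition cut (n : nat) (x : R) : R :=
  n.+1%:R^-1 * trap n.+1%:R (- (2 * n.+1%:R)) n.+1%:R x.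
Definition dcut (n : nat) (x : R) : R :=
  n.+1%:R^-1 * dtrap n.+1%:R (- (2 * n.+1%:R)) n.+1%:R x.

Lemma cut_bound n x : `|cut n x| <= 1.
Proof.
have n0 : 0 < n.+1%:R :> R by rewrite ltr0Sn.
rewrite /cut normrM gtr0_norm ?invr_gt0// mulrC ler_pdivrMr// mul1r ler_norml.
have := ramp_bound (- (2 * n.+1%:R)) x n0; have := ramp_bound n.+1%:R x n0.
by rewrite /trap => /andP[? ?] /andP[? ?]; apply/andP; split; lra.
Qed.

(** The crude bound 1 in place of 1/(n+1) is enough for a majorant; convergence comes from [dcut n]
    being eventually zero at each point. *)
Lemma dcut_bound n x : `|dcut n x| <= 1.
Proof.
have n0 : 0 < n.+1%:R :> R by rewrite ltr0Sn.
rewrite /dcut normrM gtr0_norm ?invr_gt0// mulrC ler_pdivrMr// mul1r.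
apply: (@le_trans _ _ 1); last by rewrite ler1n.
by rewrite /dtrap !indicE; case: (_ \in _); case: (_ \in _); rewrite /= ?subrr ?subr0 ?sub0r ?normrN ?normr1 ?normr0.
Qed.

Lemma cut_near x : \forall n \near \oo, cut n x = 1 /\ dcut n x = 0.
Proof.
exists (Num.trunc `|x|) => // n /= xn.
have n0 : 0 < n.+1%:R :> R by rewrite ltr0Sn.
have : `|x| < n.+1%:R.
  by apply: (lt_le_trans (truncnS_gt `|x|)); rewrite ler_nat ltnS.
rewrite /cut /dcut; move: (n.+1%:R : R) n0 => e e0 /ltr_normlP[? ?].
have -> : trap e (- (2 * e)) e x = e.
  rewrite /trap ramp_ge// ?ramp_le ?subr0//; lra.
rewrite mulVf ?gt_eqF//; split => //.
by rewrite /dtrap !indicE !memNset/= ?subrr ?mulr0//= in_itv/= => /andP[]; lra.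
Qed.

Lemma cut_locAC n : locAC (cut n).
Proof. by apply: locACM; [exact: locAC_cst|apply: trap_locAC; rewrite ltr0Sn]. Qed.

Lemma cut_is_derive n : {ae mu, forall x, is_derive x (1 : R) (cut n) (dcut n x)}.
Proof.
apply: (ae_imp (trap_is_derive (- (2 * n.+1%:R)) n.+1%:R (ltr0Sn _ n))) => x d.
exact: (is_deriveZ n.+1%:R^-1 d).
Qed.

Lemma measurable_dcut n : measurable_fun setT (dcut n).
Proof.
apply: measurable_funM; first exact: measurable_cst.
by apply: measurable_funB; apply: measurable_indic; exact: measurable_itv.
Qed.

(* The cut-off functions have slope 1/(n+1), hence the error dcut n * (F1, - F2)
   in M(q)(cut n * F) tends to 0 in L^2. *)
Lemma Dmax_closure q F G : Dmax q F G -> closure_op (Dmin q) F G.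
Proof.
move=> /DmaxP[LF ac1 ac2 LG dF].
have iF := L2_nsq_integrable LF; have iG := L2_nsq_integrable LG.
have /L2P[mF1 mF2 _] := LF; have /L2P[mG1 mG2 _] := LG.
pose Fs n : vfun := fun x => ((cut n x)%:C%C * (F x).1, (cut n x)%:C%C * (F x).2).
pose Gs n : vfun := fun x =>
  ((cut n x)%:C%C * (G x).1 + 'i * (dcut n x)%:C%C * (F x).1,
   (cut n x)%:C%C * (G x).2 + - 'i * (dcut n x)%:C%C * (F x).2).
have mcut n : cmeas (fun x => (cut n x)%:C%C).
  by apply: cmeasR; apply: continuous_measurable_fun; exact: locAC_continuous (cut_locAC n).
have mdcut n : cmeas (fun x => (dcut n x)%:C%C) by apply: cmeasR; exact: measurable_dcut.
have mFs1 n : cmeas (fun x => (Fs n x).1) by exact: cmeasM.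
have mFs2 n : cmeas (fun x => (Fs n x).2) by exact: cmeasM.
have mGs1 n : cmeas (fun x => (Gs n x).1).
  by apply: cmeasD; apply: cmeasM => //; apply: cmeasM => //; exact: cmeas_cst.
have mGs2 n : cmeas (fun x => (Gs n x).2).
  by apply: cmeasD; apply: cmeasM => //; apply: cmeasM => //; exact: cmeas_cst.
(* In the constant 8 a factor 2 comes from |z + w|^2 <= 2 |z|^2 + 2 |w|^2 and a factor 4 from (cut -
   1)^2 <= 4. One majorant serves both sequences. *)
have iFG : mu.-integrable setT (EFin \o (fun x => 8 * nsq F x + 8 * nsq G x)).
  exact: (integrableD measurableT (integrableZl measurableT 8 iF) (integrableZl measurableT 8 iG)).
have sq1 (c z : R) : `|c| <= 1 -> 0 <= z -> c ^+ 2 * z <= z.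
  by move=> /ler_normlP[? ?] z0; rewrite ler_piMl//; nra.
have sq2 (c z : R) : `|c| <= 1 -> 0 <= z -> (c - 1) ^+ 2 * z <= 4 * z.
  by move=> /ler_normlP[? ?] z0; rewrite ler_wpM2r//; nra.
have FsF n x : nsq (vsub (Fs n) F) x <= 8 * nsq F x + 8 * nsq G x.
  rewrite /nsq /vsub/=.
  rewrite (_ : _ - (F x).1 = (cut n x - 1)%:C%C * (F x).1); last by rewrite rmorphB/= mulrBl mul1r.
  rewrite (_ : _ - (F x).2 = (cut n x - 1)%:C%C * (F x).2); last by rewrite rmorphB/= mulrBl mul1r.
  rewrite !sqnM sqnR.
  have := sq2 _ _ (cut_bound n x) (sqn_ge0 (F x).1).
  have := sq2 _ _ (cut_bound n x) (sqn_ge0 (F x).2).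
  have := sqn_ge0 (F x).1; have := sqn_ge0 (F x).2.
  have := sqn_ge0 (G x).1; have := sqn_ge0 (G x).2.
  lra.
have GsG n x : nsq (vsub (Gs n) G) x <= 8 * nsq F x + 8 * nsq G x.
  rewrite /nsq /vsub/=.
  rewrite (_ : _ - (G x).1 = (cut n x - 1)%:C%C * (G x).1 + 'i * (dcut n x)%:C%C * (F x).1); last first.
    by rewrite rmorphB/= mulrBl mul1r addrAC.
  rewrite (_ : _ - (G x).2 = (cut n x - 1)%:C%C * (G x).2 + - 'i * (dcut n x)%:C%C * (F x).2); last first.
    by rewrite rmorphB/= mulrBl mul1r addrAC.
  have := sqnD ((cut n x - 1)%:C%C * (G x).1) ('i * (dcut n x)%:C%C * (F x).1).
  have := sqnD ((cut n x - 1)%:C%C * (G x).2) (- 'i * (dcut n x)%:C%C * (F x).2).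
  rewrite !sqnM sqnN sqni !sqnR !mul1r.
  have := sq2 _ _ (cut_bound n x) (sqn_ge0 (G x).1).
  have := sq2 _ _ (cut_bound n x) (sqn_ge0 (G x).2).
  have := sq1 _ _ (dcut_bound n x) (sqn_ge0 (F x).1).
  have := sq1 _ _ (dcut_bound n x) (sqn_ge0 (F x).2).
  have := sqn_ge0 (F x).1; have := sqn_ge0 (F x).2.
  lra.
split => //; exists Fs, Gs; split.
- move=> n; split; last first.
    have n0 : 0 < n.+1%:R :> R by rewrite ltr0Sn.
    exists (Num.min (- (2 * n.+1%:R)) n.+1%:R), (Num.max (- (2 * n.+1%:R)) n.+1%:R + n.+1%:R) => x.
    by move=> /(trap_support n0)[tx _]; rewrite /Fs /cut tx mulr0 !mul0r.
  have accut : clocAC (fun x => (cut n x)%:C%C) by apply: clocACR; exact: cut_locAC.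
  apply/DmaxP; split.
  + apply: (L2_dominated (mFs1 n) (mFs2 n) iF) => x.
    by rewrite /nsq/= !sqnM sqnR -mulrDr sq1 ?cut_bound// addr_ge0 ?sqn_ge0.
  + exact: clocACM.
  + exact: clocACM.
  + apply: (L2_dominated (mGs1 n) (mGs2 n) iFG) => x; rewrite /nsq/=.
    have := sqnD ((cut n x)%:C%C * (G x).1) ('i * (dcut n x)%:C%C * (F x).1).
    have := sqnD ((cut n x)%:C%C * (G x).2) (- 'i * (dcut n x)%:C%C * (F x).2).
    rewrite !sqnM sqnN sqni !sqnR !mul1r.
    have := sq1 _ _ (cut_bound n x) (sqn_ge0 (G x).1).
    have := sq1 _ _ (cut_bound n x) (sqn_ge0 (G x).2).
    have := sq1 _ _ (dcut_bound n x) (sqn_ge0 (F x).1).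
    have := sq1 _ _ (dcut_bound n x) (sqn_ge0 (F x).2).
    have := sqn_ge0 (F x).1; have := sqn_ge0 (F x).2.
    have := sqn_ge0 (G x).1; have := sqn_ge0 (G x).2.
    lra.
  + apply: (ae_imp2 dF (cut_is_derive n)) => x [d1 d2] /cderivR dc; split.
      have := cderivM dc d1; congr (cderiv _ _ _); rewrite /Fs /Gs/=.
      move: (q x) (F x).1 (F x).2 (G x).1 (cut n x) (dcut n x) => z u v w r r'.
      by complex_ring R.
    have := cderivM dc d2; congr (cderiv _ _ _); rewrite /Fs /Gs/=.
    move: (q x) (F x).1 (F x).2 (G x).2 (cut n x) (dcut n x) => z u v w r r'.
    by complex_ring R.
- apply: dist2_cvg0 iFG FsF _ => // x.
  move: (cut_near x); apply: filterS => n [c1 _].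
  by rewrite /Fs c1 !mul1r -surjective_pairing.
- apply: dist2_cvg0 iFG GsG _ => // x.
  move: (cut_near x); apply: filterS => n [c1 c0].
  by rewrite /Gs c1 c0 !mulr0 !mul0r !addr0 !mul1r -surjective_pairing.
Qed.

Lemma ip_closed (Fs Gs : nat -> vfun) F G H K :
  (forall n, L2 (Fs n)) -> (forall n, L2 (Gs n)) -> L2 F -> L2 G -> L2 H -> L2 K ->
  (fun n => dist2 (Fs n) F) @ \oo --> 0%E -> (fun n => dist2 (Gs n) G) @ \oo --> 0%E ->
  (forall n, ip (Fs n) H = ip (Gs n) K) -> ip F H = ip G K.
Proof.
move=> LFs LGs LF LG LH LK cF cG E.
have [fr fi] := ip_cvg LFs LF LH cF; have [gr gi] := ip_cvg LGs LG LK cG.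
have Er : (fun n => complex.Re (ip (Fs n) H)) = (fun n => complex.Re (ip (Gs n) K)).
  by apply/funext => n; rewrite E.
have Ei : (fun n => complex.Im (ip (Fs n) H)) = (fun n => complex.Im (ip (Gs n) K)).
  by apply/funext => n; rewrite E.
rewrite Er in fr; rewrite Ei in fi.
apply: complex_eqP; first exact: (cvg_unique (@Rhausdorff R) fr gr).
exact: (cvg_unique (@Rhausdorff R) fi gi).
Qed.

Lemma Dmax_L2 q F G : Dmax q F G -> L2 F /\ L2 G.
Proof. by case. Qed.

(** The adjoint relation for [Dmin q] extends to its closure by continuity of the inner product, and
    that closure contains [Dmax q]: no boundary term at infinity is ever evaluated. *)
Lemma Dmax_adj q F G : Dmax (fun x => - q x) F G -> adj (Dmax q) F G.
Proof.
move=> DF; have [LF LG] := Dmax_L2 DF; split => // H K /Dmax_closure[LH LK [Hs [Ks [D cH cK]]]].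
apply: (ip_closed _ _ LK LH LF LG cK cH) => n.
- by have [] := Dmax_L2 (D n).1.
- by have [] := Dmax_L2 (D n).1.
- exact: Dmin_adj (D n) DF.
Qed.

Lemma oppr_funK q : (fun x => - - q x) = q.
Proof. by apply/funext => x; rewrite opprK. Qed.

Lemma closure_Dmin_adj q F G : closure_op (Dmin q) F G -> adj (Dmin (fun x => - q x)) F G.
Proof.
move=> [LF LG [Fs [Gs [D cF cG]]]]; split => // H K DH; have [LH LK] := Dmax_L2 DH.1.
have LFs n : L2 (Fs n) by have [] := Dmax_L2 (D n).1.
have LGs n : L2 (Gs n) by have [] := Dmax_L2 (D n).1.
(* Limits are taken in the first argument of [ip], so the approximating sequences are moved there by
   conjugate symmetry. *)
rewrite (ipC LF LK) (ipC LG LH); congr (_^*).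
apply: (ip_closed LFs LGs LF LG LK LH cF cG) => n.
rewrite (ipC LK (LFs n)) (ipC LH (LGs n)); congr (_^*).
by apply: Dmin_adj DH _; rewrite oppr_funK; exact: (D n).1.
Qed.

Lemma closure_Dmin_regular q F G : L1loc q -> closure_op (Dmin q) F G ->
  exists2 U, aeq F U & Dmax q U G.
Proof.
move=> lq /closure_Dmin_adj/(adj_Dmin_regular (L1locN lq))[U FU].
by rewrite oppr_funK; exists U.
Qed.

(** * The conjugation J *)

Lemma JmapK F : Jmap (Jmap F) = F.
Proof.
by apply/funext => x; rewrite /Jmap/= !conjCK -surjective_pairing.
Qed.

Lemma L2J F : L2 F -> L2 (Jmap F).
Proof.
move=> LF; have /L2P[m1 m2 _] := LF.
apply: (L2_dominated _ _ (L2_nsq_integrable LF)); [exact: cmeasJ|exact: cmeasJ|].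
by move=> x; rewrite /nsq/= !sqnJ addrC.
Qed.

(** Conjugating and swapping the components exchanges the two rows of the system, and the conjugated
    second row is the first row for -q. *)
Lemma DmaxJ q F G : Dmax q F G -> Dmax (fun x => - q x) (Jmap F) (Jmap G).
Proof.
move=> /DmaxP[LF ac1 ac2 LG dF]; apply/DmaxP; split.
- exact: L2J.
- exact: clocACJ.
- exact: clocACJ.
- exact: L2J.
- apply: (ae_imp dF) => x [/cderivJ d1 /cderivJ d2]; split.
    move: d2; congr (cderiv _ _ _); rewrite /Jmap/=.
    by move: (q x) (F x).1 (G x).2 => z u v; complex_ring R.
  move: d1; congr (cderiv _ _ _); rewrite /Jmap/=.
  by move: (q x) (F x).2 (G x).1 => z u v; complex_ring R.
Qed.

Lemma DmaxNJ q F G : Dmax (fun x => - q x) F G -> Dmax q (Jmap F) (Jmap G).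
Proof. by move=> /DmaxJ; rewrite oppr_funK. Qed.

Lemma aeq_trans F G H : aeq F G -> aeq G H -> aeq F H.
Proof. by move=> FG GH; apply: (ae_imp2 FG GH) => x -> ->. Qed.

Lemma aeqJ F G : aeq F G -> aeq (Jmap F) (Jmap G).
Proof. by move=> FG; apply: (ae_imp FG) => x e; rewrite /Jmap e. Qed.

End Closure.

(** * The three operator identities *)

Theorem theorem3p5 (R : realType) (q : R -> R[i]) (hq : L1loc q) :
  opeq (closure_op (Dmin q)) (Jconj (adj (Dmin q))) /\
  opeq (closure_op (Dmin q)) (Dmax q) /\
  opeq (Jconj (Dmax q)) (adj (Dmax q)).
Proof.
split; [|split] => F G; split=> -[F' [G' [FF' GG' D]]].
(* [closure_op] does not distinguish measurable representatives, [Dmax] does; hence the witness is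
   the regular one [U]. *)
- have [U FU DU] := closure_Dmin_regular hq D.
  exists U, G'; split; [exact: aeq_trans FF' FU|exact: GG'|].
  have [LU LG] := Dmax_L2 (DmaxJ DU); split => // H K DH.
  exact: Dmin_adj DH (DmaxJ DU).
- have [U FU DU] := adj_Dmin_regular hq D.
  (* [D] concerns [Jmap F'], so its regular representative [U] is conjugated back. *)
  exists (Jmap U), G'; split; [|exact: GG'|].
    by apply: aeq_trans FF' _; rewrite -[F']JmapK; exact: aeqJ.
  by apply: Dmax_closure; have := DmaxNJ DU; rewrite JmapK.
- have [U FU DU] := closure_Dmin_regular hq D.
  by exists U, G'; split; [exact: aeq_trans FF' FU|exact: GG'|exact: DU].
- by exists F', G'; split; [exact: FF'|exact: GG'|exact: Dmax_closure].
- exists F', G'; split; [exact: FF'|exact: GG'|apply: Dmax_adj].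
  by have := DmaxJ D; rewrite !JmapK.
- have [LF LG DF] := D.
  (* A pair in the adjoint of [Dmax q] lies in that of its restriction [Dmin q], where a regular
     representative exists. *)
  have [U FU DU] : exists2 U, aeq F' U & Dmax (fun x => - q x) U G'.
    by apply: adj_Dmin_regular => //; split => // H K [DH _]; exact: DF.
  exists U, G'; split; [exact: aeq_trans FF' FU|exact: GG'|].
  exact: DmaxNJ.
Qed.
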